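(* The operations of forming direct sums and tensor products of algebraic structures induce two coproducts $\Delta,\Delta^{\otimes}:K[X]\to K[X]\otimes K[X]$ on $K[X]$, and: (1) The coproduct $\Delta$ equips the algebra $K[X]$ with a Hopf algebra structure. The connected diagrams $p$ are primitive with respect to this coproduct: $\Delta(p)=p\otimes 1+1\otimes p$ and $\epsilon(p)=0$. (2) The coproduct $\Delta^{\otimes}$ equips the algebra $K[X]$ with a bialgebra structure. All the diagrams $p$ are group-like with respect to this coproduct: $\Delta^{\otimes}(p)=p\otimes p$ and $\epsilon_{\otimes}(p)=1$.
   Context: $K$ is an algebraically closed field of characteristic zero and a type $((p_1,q_1),\ldots,(p_r,q_r))\in(\mathbb{N}^2)^r$ is fixed. An algebraic structure of this type is a finite dimensional $K$-vector space $W$ with tensors $x_i\in W^{p_i,q_i}=W^{\otimes p_i}\otimes(W^* )^{\otimes q_i}\cong\mathrm{Hom}_K(W^{\otimes q_i},W^{\otimes p_i})$, $i=1,\ldots,r$. A closed diagram (without $\mathrm{Id}_W$) is a finite list of boxes, each labelled by one of $x_1,\ldots,x_r$, where a box labelled $x_i$ has $q_i$ ordered input strings and $p_i$ ordered output strings, together with a bijection (connection) from the set of all output strings to the set of all input strings. On an algebraic structure $(W,(x_i))$ a closed diagram takes a scalar value: take the tensor product of the tensors labelling the boxes and apply the evaluation $W\otimes W^*\to K$ for each connected pair of an output and an input string. Two closed diagrams are equivalent if they take the same value on every algebraic structure (equivalently, if they differ by permuting the boxes). $K[X]$ is the free $K$-vector space on equivalence classes of such closed diagrams, with product given by juxtaposition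 (disjoint union) and unit the empty diagram. A diagram is connected if it is nonempty and connected as a graph. By linearity every $f\in K[X]$ has a value $f(W,(x_i))\in K$ on every algebraic structure. The direct sum of $(W_1,(x_i))$ and $(W_2,(y_i))$ is $(W_1\oplus W_2,(x_i\oplus y_i))$, where $x_i\oplus y_i$ is the image of $(x_i,y_i)$ under the natural map $W_1^{p_i,q_i}\oplus W_2^{p_i,q_i}\to(W_1\oplus W_2)^{p_i,q_i}$ (for $(p_i,q_i)=(0,0)$ this is the sum of scalars). The tensor product is $(W_1\otimes W_2,(x_i\otimes y_i))$ with $x_i\otimes y_i\in W_1^{p_i,q_i}\otimes W_2^{p_i,q_i}\cong(W_1\otimes W_2)^{p_i,q_i}$. That the operation $\oplus$ (resp. $\otimes$) induces the coproduct $\Delta$ (resp. $\Delta^\otimes$) means: $\Delta$ (resp. $\Delta^{\otimes}$) is the linear map such that for every $f\in K[X]$, writing the image of $f$ as $\sum_j f_j'\otimes f_j''$, one has $\sum_j f_j'(W_1,(x_i))f_j''(W_2,(y_i))=f\big((W_1,(x_i))\oplus(W_2,(y_i))\big)$ (resp. $=f\big((W_1,(x_i))\otimes(W_2,(y_i))\big)$) for all algebraic structures. The counit $\epsilon$ for $\Delta$ is evaluation at the zero-dimensional structure with zero tensors; the counit $\epsilon_\otimes$ for $\Delta^\otimes$ is evaluation at the structure $(K,(1))$ with $x_i=1\in K^{p_i,q_i}\cong K$. *)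

(* Defs.v *)
From HB Require Import structures.
From mathcomp Require Import all_boot all_algebra.
From mathcomp Require Import boolp.
From mathcomp Require Import finmap monalg.

Set Implicit Arguments.
Unset Strict Implicit.
Unset Printing Implicit Defensive.

Import GRing.Theory.
Local Open Scope ring_scope.
Local Open Scope quotient_scope.

Definition ord0_elim (T : 'I_0 -> Type) (b : 'I_0) : T b :=
  False_rect (T b) (notF (etrans (esym (ltn0 b)) (ltn_ord b))).

Section Tensors.
Context {K : closedFieldType}.
Implicit Types W : vectType K.

Definition dual W : vectType K := 'Hom(W, K^o).

Definition upd (p : nat) (T : Type) (f : {ffun 'I_p -> T}) (j : 'I_p) (u : T) :
  {ffun 'I_p -> T} := [ffun k => if k == j then u else f k].

(* W^{p,q}, for W of finite dimension, as the space of multilinear forms on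
   (W^* )^p x W^q. *)
Record tensor W (p q : nat) := Tensor {
  tapp :> {ffun 'I_p -> dual W} -> {ffun 'I_q -> W} -> K;
  tensor_linl : forall phi w j, scalar (fun u : dual W => tapp (upd phi j u) w);
  tensor_linr : forall phi w j, scalar (fun u : W => tapp phi (upd w j u))
}.

Definition idx W := 'I_(\dim {:W}).
Definition bas W (i : idx W) : W := (vbasis {:W})`_i.
Definition cobas W (i : idx W) : dual W :=
  linfun (coord (vbasis {:W}) i : W -> K^o).

Lemma prod_upd (n : nat) (A : Type) (F : 'I_n -> A -> K) (f : {ffun 'I_n -> A}) j u :
  \prod_k F k (upd f j u k) = F j u * \prod_(k | k != j) F k (f k).
Proof.
rewrite (bigD1 j) //= ffunE eqxx; congr (_ * _).
by apply: eq_bigr => k nkj; rewrite ffunE (negPf nkj).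
Qed.

Lemma linfunE (V W : vectType K) (F : V -> W) : linear F -> linfun F =1 F.
Proof.
move=> linF; pose L := GRing.isLinear.Build K _ _ _ F linF.
pose G : {linear V -> W} := HB.pack F L.
exact: (lfunE G).
Qed.

Section Zero.
Variables (W : vectType K) (p q : nat).

Definition zero_tapp (phi : {ffun 'I_p -> dual W}) (w : {ffun 'I_q -> W}) : K := 0.

Lemma zero_linl phi w j : scalar (fun u : dual W => zero_tapp (upd phi j u) w).
Proof. by move=> a u v; rewrite /zero_tapp mulr0 addr0. Qed.

Lemma zero_linr phi w j : scalar (fun u : W => zero_tapp phi (upd w j u)).
Proof. by move=> a u v; rewrite /zero_tapp mulr0 addr0. Qed.

Definition zero_tensor : tensor W p q := Tensor zero_linl zero_linr.
End Zero.

Section One.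
Variables (p q : nat).

(* The element 1 of K^{p,q} = K. *)
Definition one_tapp (phi : {ffun 'I_p -> dual K^o}) (w : {ffun 'I_q -> K^o}) : K :=
  (\prod_k phi k (1 : K^o)) * \prod_k w k.

Lemma one_linl phi w j : scalar (fun u : dual K^o => one_tapp (upd phi j u) w).
Proof.
move=> a u v; rewrite /one_tapp.
have E := prod_upd (fun (_ : 'I_p) (f : dual K^o) => f (1 : K^o) : K) phi j.
rewrite !{}E add_lfunE scale_lfunE mulrDl mulrDl; congr (_ + _).
by rewrite /GRing.scale /= !mulrA.
Qed.

Lemma one_linr phi w j : scalar (fun u : K^o => one_tapp phi (upd w j u)).
Proof.
move=> a u v; rewrite /one_tapp.
have E := prod_upd (fun (_ : 'I_q) (x : K^o) => x : K) w j.
rewrite !{}E mulrDl mulrDr; congr (_ + _).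
by rewrite /GRing.scale /= -mulrA mulrCA.
Qed.

Definition one_tensor : tensor K^o p q := Tensor one_linl one_linr.
End One.

Section DirectSum.
Variables (W1 W2 : vectType K) (p q : nat).

Definition injl : 'Hom(W1, (W1 * W2)%type) := linfun (fun u => (u, 0)).
Definition injr : 'Hom(W2, (W1 * W2)%type) := linfun (fun v => (0, v)).

Lemma injlE u : injl u = (u, 0).
Proof. by apply: linfunE => a v w; congr pair; rewrite /= scaler0 addr0. Qed.
Lemma injrE v : injr v = (0, v).
Proof. by apply: linfunE => a u w; congr pair; rewrite /= scaler0 addr0. Qed.

Definition restl (phi : dual (W1 * W2)%type) : dual W1 := (phi \o injl)%VF.
Definition restr (phi : dual (W1 * W2)%type) : dual W2 := (phi \o injr)%VF.

(* The image of (x, y) under W1^{p,q} + W2^{p,q} -> (W1 + W2)^{p,q}: the map is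
   induced by the inclusions W_i -> W1 + W2 and, on the dual factors, by the
   transposes of the projections. *)
Definition dsum_tapp (x : tensor W1 p q) (y : tensor W2 p q)
    (phi : {ffun 'I_p -> dual (W1 * W2)%type})
    (w : {ffun 'I_q -> (W1 * W2)%type}) : K :=
  x [ffun k => restl (phi k)] [ffun k => (w k).1] +
  y [ffun k => restr (phi k)] [ffun k => (w k).2].

Lemma upd_map (n : nat) (A B : Type) (g : A -> B) (f : {ffun 'I_n -> A}) j u :
  [ffun k => g (upd f j u k)] = upd [ffun k => g (f k)] j (g u).
Proof. by apply/ffunP => k; rewrite !ffunE; case: ifP. Qed.

Lemma dsum_linl x y phi w j :
  scalar (fun u : dual (W1 * W2)%type => dsum_tapp x y (upd phi j u) w).
Proof.
move=> a u v; rewrite /dsum_tapp !upd_map /restl /restr.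
by rewrite !comp_lfunDl -!comp_lfunZl !tensor_linl mulrDr addrACA.
Qed.

Lemma dsum_linr x y phi w j :
  scalar (fun u : (W1 * W2)%type => dsum_tapp x y phi (upd w j u)).
Proof.
move=> a u v; rewrite /dsum_tapp (upd_map fst) (upd_map snd).
rewrite (upd_map fst _ _ u) (upd_map snd _ _ u) (upd_map fst _ _ v).
by rewrite (upd_map snd _ _ v) /= !tensor_linr mulrDr addrACA.
Qed.

Definition dsum_tensor (x : tensor W1 p q) (y : tensor W2 p q) :
  tensor (W1 * W2)%type p q := Tensor (dsum_linl x y) (dsum_linr x y).
End DirectSum.

Section Expansion.
Variables (V : lmodType K) (I : finType) (e : I -> V).

Definition fcons (T : Type) n (u : T) (f : {ffun 'I_n -> T}) : {ffun 'I_n.+1 -> T} :=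
  [ffun k => if unlift ord0 k is Some k' then f k' else u].

Lemma upd_fcons0 (T : Type) n (u v : T) (f : {ffun 'I_n -> T}) :
  upd (fcons u f) ord0 v = fcons v f.
Proof. by apply/ffunP => k; rewrite !ffunE; case: unliftP => [j|] ->. Qed.

Lemma upd_fconsS (T : Type) n (u v : T) (f : {ffun 'I_n -> T}) j :
  upd (fcons u f) (lift ord0 j) v = fcons u (upd f j v).
Proof.
apply/ffunP => k; rewrite !ffunE.
by case: unliftP => [i|] -> //; rewrite ffunE (inj_eq lift_inj).
Qed.

Lemma fcons_map (T T' : Type) n (h : T -> T') (u : T) (f : {ffun 'I_n -> T}) :
  [ffun k => h (fcons u f k)] = fcons (h u) [ffun k => h (f k)].
Proof. by apply/ffunP => k; rewrite !ffunE; case: unlift => [j|] //; rewrite ffunE. Qed.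

Lemma scalar_comb (F : V -> K) (c : I -> K) (x : I -> V) :
  scalar F -> F (\sum_i c i *: x i) = \sum_i c i * F (x i).
Proof.
move=> linF; have F0 : F 0 = 0.
  by have := linF (-1) 0 0; rewrite scaler0 addr0 mulN1r addNr.
apply: (big_ind2 (fun u s => F u = s)) => //.
  by move=> u _ v _ <- <-; have := linF 1 u v; rewrite scale1r mul1r.
by move=> i _; have := linF (c i) (x i) 0; rewrite F0 !addr0.
Qed.

Lemma multilinear_expand n (g : {ffun 'I_n -> V} -> K) (c : 'I_n -> I -> K) :
  (forall f j, scalar (fun u => g (upd f j u))) ->
  g [ffun k => \sum_i c k i *: e i] =
  \sum_(a : {ffun 'I_n -> I}) (\prod_k c k (a k)) * g [ffun k => e (a k)].
Proof.
elim: n g c => [|n IHn] g c lin_g.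
  rewrite (big_pred1 [ffun k : 'I_0 => ord0_elim (fun=> I) k]).
    by rewrite big_ord0 mul1r; congr g; apply/ffunP => -[].
  by move=> a; apply/esym/eqP/ffunP => -[].
have -> : [ffun k => \sum_i c k i *: e i] = fcons (\sum_i c ord0 i *: e i)
    [ffun k => \sum_i c (lift ord0 k) i *: e i].
  by apply/ffunP => k; rewrite !ffunE; case: unliftP => [j|] -> //; rewrite ffunE.
rewrite (@scalar_comb (fun u => g (fcons u _))); last first.
  move=> a u v; set f := finfun _.
  by have := lin_g (fcons 0 f) ord0 a u v; rewrite !upd_fcons0.
rewrite (reindex (fun z : I * {ffun 'I_n -> I} => fcons z.1 z.2)) /=; last first.
  apply: onW_bij; exists (fun a : {ffun 'I_n.+1 -> I} => (a ord0, [ffun k => a (lift ord0 k)])).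
    case=> i a; congr pair; first by rewrite ffunE unlift_none.
    by apply/ffunP => k; rewrite !ffunE liftK.
  by move=> a; apply/ffunP => k; rewrite !ffunE; case: unliftP => [j|] -> //; rewrite ffunE.
rewrite -(pair_bigA _ (fun i a => (\prod_k c k (fcons i a k)) *
  g [ffun k => e (fcons i a k)])) /=.
apply: eq_bigr => i _.
rewrite (IHn (fun f => g (fcons (e i) f))); last first.
  move=> f j a u v.
  by have := lin_g (fcons (e i) f) (lift ord0 j) a u v; rewrite !upd_fconsS.
rewrite mulr_sumr; apply: eq_bigr => a _.
rewrite big_ord_recl ffunE unlift_none -mulrA fcons_map; congr (_ * (_ * _)).
by apply: eq_bigr => k _; rewrite ffunE liftK.
Qed.

End Expansion.

Section TensorExpansion.
Variables (W : vectType K).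

Lemma cobasE (i : idx W) (u : W) : cobas i u = coord (vbasis {:W}) i u.
Proof. by rewrite lfunE. Qed.

Lemma bas_expand (u : W) : u = \sum_i cobas i u *: bas i.
Proof.
rewrite {1}(coord_vbasis (memvf u)); apply: eq_bigr => i _.
by rewrite cobasE.
Qed.

Lemma cobas_expand (phi : dual W) : phi = \sum_i phi (bas i) *: cobas i.
Proof.
apply/lfunP => u; rewrite sum_lfunE {1}(bas_expand u) linear_sum /=.
by apply: eq_bigr => i _; rewrite linearZ scale_lfunE /= /GRing.scale /= mulrC.
Qed.

Lemma tensor_expand p q (x : tensor W p q) phi w :
  x phi w = \sum_(a : {ffun 'I_p -> idx W}) \sum_(c : {ffun 'I_q -> idx W})
    (\prod_k phi k (bas (a k))) * (\prod_k cobas (c k) (w k)) *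
    x [ffun k => cobas (a k)] [ffun k => bas (c k)].
Proof.
have {1}-> : phi = [ffun k => \sum_i (phi k (bas i) : K) *: cobas i].
  by apply/ffunP => k; rewrite ffunE -cobas_expand.
rewrite (multilinear_expand _ (g := fun f => x f w)); last first.
  by move=> f j; apply: tensor_linl.
apply: eq_bigr => a _.
have {1}-> : w = [ffun k => \sum_i (cobas i (w k) : K) *: bas i].
  by apply/ffunP => k; rewrite ffunE -bas_expand.
rewrite (multilinear_expand _ (g := fun f => x _ f)); last first.
  by move=> f j; apply: tensor_linr.
by rewrite mulr_sumr; apply: eq_bigr => c _; rewrite mulrA.
Qed.

End TensorExpansion.

Section TensorProduct.
Variables (W1 W2 : vectType K) (p q : nat).

(* W1 (x) W2 = Hom(W1^*, W2), the pure tensor u (x) v being phi |-> phi(u) v.  *)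
Definition tprod : vectType K := 'Hom(dual W1, W2).
Definition pure (u : W1) (v : W2) : tprod :=
  linfun (fun phi : dual W1 => (phi u : K) *: v).

(* The form phi (x) psi on W1 (x) W2 is t |-> psi (t phi). *)
Definition dpure (phi : dual W1) (psi : dual W2) : dual tprod :=
  linfun (fun t : tprod => psi (t phi)).

(* The multilinear form whose value at (phi_k (x) psi_k)_k, (u_k (x) v_k)_k is
   x (phi, u) * y (psi, v), cf. tprod_tensor_pure below; general arguments are
   expanded along the bases of pure tensors of W1 (x) W2 and its dual. *)
Definition tprod_tapp (x : tensor W1 p q) (y : tensor W2 p q)
    (phi : {ffun 'I_p -> dual tprod}) (w : {ffun 'I_q -> tprod}) : K :=
  \sum_(a : {ffun 'I_p -> idx W1 * idx W2})
   \sum_(c : {ffun 'I_q -> idx W1 * idx W2})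
    (\prod_k phi k (pure (bas (a k).1) (bas (a k).2))) *
    (\prod_k dpure (cobas (c k).1) (cobas (c k).2) (w k)) *
    (x [ffun k => cobas (a k).1] [ffun k => bas (c k).1] *
     y [ffun k => cobas (a k).2] [ffun k => bas (c k).2]).

Lemma tprod_linl x y phi w j :
  scalar (fun u : dual tprod => tprod_tapp x y (upd phi j u) w).
Proof.
move=> a u v; rewrite /tprod_tapp mulr_sumr -big_split; apply: eq_bigr => b _ /=.
rewrite mulr_sumr -big_split; apply: eq_bigr => c _ /=.
have E := prod_upd (fun k (f : dual tprod) =>
  f (pure (bas (b k).1) (bas (b k).2)) : K) phi j.
by rewrite !E add_lfunE scale_lfunE !mulrDl !mulrA.
Qed.

Lemma tprod_linr x y phi w j :
  scalar (fun u : tprod => tprod_tapp x y phi (upd w j u)).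
Proof.
move=> a u v; rewrite /tprod_tapp mulr_sumr -big_split; apply: eq_bigr => b _ /=.
rewrite mulr_sumr -big_split; apply: eq_bigr => c _ /=.
have E := prod_upd (fun k (t : tprod) =>
  dpure (cobas (c k).1) (cobas (c k).2) t : K) w j.
rewrite !E linearP /= !mulrDl !mulrDr !mulrDl; congr (_ + _).
by rewrite -!mulrA mulrCA.
Qed.

Definition tprod_tensor (x : tensor W1 p q) (y : tensor W2 p q) :
  tensor tprod p q := Tensor (tprod_linl x y) (tprod_linr x y).

Lemma pureE u v (phi : dual W1) : pure u v phi = (phi u : K) *: v.
Proof.
apply: linfunE => a f g.
by rewrite add_lfunE scale_lfunE scalerDl scalerA.
Qed.

Lemma dpureE phi psi u v :
  dpure phi psi (pure u v) = (phi u : K) * psi v :> K.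
Proof.
rewrite linfunE => [|a f g]; first by rewrite pureE linearZ.
by rewrite add_lfunE scale_lfunE linearP.
Qed.

Lemma tprod_tensor_pure x y (phi : {ffun 'I_p -> dual W1})
    (psi : {ffun 'I_p -> dual W2}) (u : {ffun 'I_q -> W1}) (v : {ffun 'I_q -> W2}) :
  tprod_tensor x y [ffun k => dpure (phi k) (psi k)] [ffun k => pure (u k) (v k)] =
  x phi u * y psi v.
Proof.
rewrite (tensor_expand x) (tensor_expand y) big_distrlr /= pair_big /=.
rewrite /tprod_tapp (reindex (fun z : {ffun 'I_p -> idx W1} * {ffun 'I_p -> idx W2} =>
  [ffun k => (z.1 k, z.2 k)])) /=; last first.
  apply: onW_bij; exists (fun a : {ffun 'I_p -> idx W1 * idx W2} =>
    ([ffun k => (a k).1], [ffun k => (a k).2])).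
    by case=> a b; congr pair; apply/ffunP => k; rewrite !ffunE.
  by move=> a; apply/ffunP => k; rewrite !ffunE /=; case: (a k).
apply: eq_bigr => -[a b] _ /=; rewrite big_distrlr /= pair_big /=.
rewrite (reindex (fun z : {ffun 'I_q -> idx W1} * {ffun 'I_q -> idx W2} =>
  [ffun k => (z.1 k, z.2 k)])) /=; last first.
  apply: onW_bij; exists (fun a : {ffun 'I_q -> idx W1 * idx W2} =>
    ([ffun k => (a k).1], [ffun k => (a k).2])).
    by case=> c d; congr pair; apply/ffunP => k; rewrite !ffunE.
  by move=> c; apply/ffunP => k; rewrite !ffunE /=; case: (c k).
apply: eq_bigr => -[c d] _ /=.
under eq_bigr do rewrite !ffunE dpureE.
rewrite big_split /=.
have -> : \prod_k dpure (cobas ([ffun k => (c k, d k)] k).1)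
    (cobas ([ffun k => (c k, d k)] k).2) ([ffun k => pure (u k) (v k)] k) =
    (\prod_k cobas (c k) (u k)) * \prod_k cobas (d k) (v k) :> K.
  by rewrite -big_split; apply: eq_bigr => k _ /=; rewrite !ffunE dpureE.
have E (A B : finType) (C : Type) (n : nat) (g : A -> C) (a' : {ffun 'I_n -> A})
    (b' : {ffun 'I_n -> B}) :
    [ffun k => g ([ffun k => (a' k, b' k)] k).1] = [ffun k => g (a' k)].
  by apply/ffunP => k; rewrite !ffunE.
have E' (A B : finType) (C : Type) (n : nat) (g : B -> C) (a' : {ffun 'I_n -> A})
    (b' : {ffun 'I_n -> B}) :
    [ffun k => g ([ffun k => (a' k, b' k)] k).2] = [ffun k => g (b' k)].
  by apply/ffunP => k; rewrite !ffunE.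
by rewrite !E !E' [RHS]mulrACA; congr (_ * _); apply: mulrACA.
Qed.
End TensorProduct.

End Tensors.

(* The tensor product of the free modules {malg K[M]} and {malg K[N]} is
   {malg K[(M * N)%type]}: the basis element << (m, n) >> is the pure tensor of
   << m >> and << n >>, cf. tpure_universal below. *)
Section ProductMonomials.

Section Monom.
Variables M N : monomType.

Definition pmone : M * N := (mone, mone).
Definition pmmul (x y : M * N) : M * N := (mmul x.1 y.1, mmul x.2 y.2).

Lemma pmmulA : associative pmmul.
Proof. by move=> x y z; rewrite /pmmul /= !mulmA. Qed.
Lemma pmmul1m : left_id pmone pmmul.
Proof. by case=> x y; rewrite /pmmul /= !mul1m. Qed.
Lemma pmmulm1 : right_id pmone pmmul.
Proof. by case=> x y; rewrite /pmmul /= !mulm1. Qed.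
Lemma pmunitm x y : pmmul x y = pmone -> x = pmone /\ y = pmone.
Proof. by case: x y => [x x'] [y y'] [/unitm[-> ->] /unitm[-> ->]]. Qed.

HB.instance Definition _ := Choice_isMonomialDef.Build (M * N)%type
  pmmulA pmmul1m pmmulm1 pmunitm.
End Monom.

Lemma pmmulC (M N : conomType) : commutative (@mmul (M * N)%type).
Proof. by case=> x x' [y y']; congr pair; apply: mulmC. Qed.

HB.instance Definition _ (M N : conomType) :=
  MonomialDef_isConomialDef.Build (M * N)%type (@pmmulC M N).

End ProductMonomials.

Section LinearExtension.
Variables (K : closedFieldType) (M : choiceType) (V : lmodType K) (h : M -> V).

Definition lext (f : {malg K[M]}) : V := \sum_(m <- msupp f) f@_m *: h m.

Lemma lextEw (d : {fset M}) f :
  (msupp f `<=` d)%fset -> lext f = \sum_(m <- d) f@_m *: h m.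
Proof.
move=> le; apply: big_fset_incl => // m _ nm.
by rewrite mcoeff_outdom // scale0r.
Qed.

Lemma lextU m : lext << m >> = h m.
Proof. by rewrite (lextEw (msuppU_le (k := m))) big_seq_fset1 mcoeffUU scale1r. Qed.

Lemma lext_linear : linear lext.
Proof.
move=> a f g; pose d := (msupp f `|` msupp g)%fset.
rewrite (@lextEw d (a *: f + g)); last first.
  apply: fsubset_trans (msuppD_le _ _) _.
  by apply: fsetSU; apply: msuppZ_le.
rewrite (@lextEw d f) ?fsubsetUl // (@lextEw d g) ?fsubsetUr //.
rewrite scaler_sumr -big_split; apply: eq_bigr => m _ /=.
by rewrite mcoeffD mcoeffZ scalerDl scalerA.
Qed.

End LinearExtension.

Section TensorAlgebra.
Context {K : closedFieldType}.

Definition tpure (M N : choiceType) (f : {malg K[M]}) (g : {malg K[N]}) :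
    {malg K[(M * N)%type]} :=
  lext (fun m => lext (fun n => << (m, n) >>) g) f.

Definition tmap (M M' N N' : choiceType) (F : {malg K[M]} -> {malg K[M']})
    (G : {malg K[N]} -> {malg K[N']}) : {malg K[(M * N)%type]} -> {malg K[(M' * N')%type]} :=
  lext (fun x : (M * N)%type => tpure (F << x.1 >>) (G << x.2 >>)).

Definition tassoc (M N P : choiceType) :
    {malg K[((M * N) * P)%type]} -> {malg K[(M * (N * P))%type]} :=
  lext (fun x : ((M * N) * P)%type => << (x.1.1, (x.1.2, x.2)) >>).

(* eps (x) id and id (x) eps, followed by K (x) A = A and A (x) K = A. *)
Definition tcounitl (M : choiceType) (eps : {malg K[M]} -> K) :
    {malg K[(M * M)%type]} -> {malg K[M]} :=
  lext (fun x : (M * M)%type => eps << x.1 >> *: << x.2 >>).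
Definition tcounitr (M : choiceType) (eps : {malg K[M]} -> K) :
    {malg K[(M * M)%type]} -> {malg K[M]} :=
  lext (fun x : (M * M)%type => eps << x.2 >> *: << x.1 >>).

Definition tmul (M : conomType) : {malg K[(M * M)%type]} -> {malg K[M]} :=
  lext (fun x : (M * M)%type => << x.1 >> * << x.2 >>).

Record bialgebra (M : conomType) (Delta : {malg K[M]} -> {malg K[(M * M)%type]})
    (eps : {malg K[M]} -> K) : Prop := Bialgebra {
  comult_linear : linear Delta;
  counit_linear : scalar eps;
  comult_assoc : forall f,
    tassoc (tmap Delta idfun (Delta f)) = tmap idfun Delta (Delta f);
  comult_counitl : forall f, tcounitl eps (Delta f) = f;
  comult_counitr : forall f, tcounitr eps (Delta f) = f;
  comult_morph : GRing.monoid_morphism Delta;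
  counit_morph : GRing.monoid_morphism eps
}.

Definition antipode (M : conomType) (Delta : {malg K[M]} -> {malg K[(M * M)%type]})
    (eps : {malg K[M]} -> K) (S : {malg K[M]} -> {malg K[M]}) : Prop :=
  [/\ linear S,
      forall f, tmul (tmap S idfun (Delta f)) = eps f *: 1 &
      forall f, tmul (tmap idfun S (Delta f)) = eps f *: 1].

Definition hopf_algebra (M : conomType) (Delta : {malg K[M]} -> {malg K[(M * M)%type]})
    (eps : {malg K[M]} -> K) : Prop :=
  bialgebra Delta eps /\ exists S, antipode Delta eps S.

Lemma sumsupp (M : choiceType) (f : {malg K[M]}) :
  f = \sum_(m <- msupp f) f@_m *: << m >>.
Proof.
rewrite {1}[f]monalgE; apply: eq_bigr => m _.
by apply/malgP => n; rewrite mcoeffZ !mcoeffU mulrnAr mulr1.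
Qed.

Lemma linear_comb (U V : lmodType K) (F : U -> V) (I : Type) (s : seq I)
    (c : I -> K) (x : I -> U) :
  linear F -> F (\sum_(i <- s) c i *: x i) = \sum_(i <- s) c i *: F (x i).
Proof.
move=> linF; have F0 : F 0 = 0 by have := linF (-1) 0 0; rewrite !scaler0 addr0 scaleN1r addNr.
elim: s => [|i s IH]; first by rewrite !big_nil.
by rewrite !big_cons linF IH.
Qed.

Lemma tpure_universal (M N : choiceType) (V : lmodType K)
    (B : {malg K[M]} -> {malg K[N]} -> V) :
  (forall g, linear (B^~ g)) -> (forall f, linear (B f)) ->
  exists F : {malg K[(M * N)%type]} -> V,
    [/\ linear F, forall f g, F (tpure f g) = B f g &
      forall F', linear F' -> (forall f g, F' (tpure f g) = B f g) -> F' =1 F].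
Proof.
move=> linl linr; exists (lext (fun x : (M * N)%type => B << x.1 >> << x.2 >>)).
split=> [|f g|F' linF' F'B T]; first exact: lext_linear.
  rewrite [in RHS](sumsupp f) (linear_comb _ _ _ (linl g)) /tpure.
  rewrite (linear_comb _ _ _ (@lext_linear _ _ _ _)).
  apply: eq_bigr => m _; congr (_ *: _).
  rewrite [in RHS](sumsupp g) (linear_comb _ _ _ (linr _)).
  rewrite (linear_comb _ _ _ (@lext_linear _ _ _ _)).
  by apply: eq_bigr => n _; rewrite lextU.
rewrite [in LHS](sumsupp T) (linear_comb _ _ _ linF'); apply: eq_bigr => -[m n] _.
by rewrite -F'B /tpure !lextU.
Qed.

End TensorAlgebra.

Notation "f \ot g" := (tpure f g) (at level 40, left associativity) : ring_scope.

Section Structures.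
Variables (K : closedFieldType) (r : nat) (t : 'I_r -> nat * nat).

Record algstr := Algstr {
  space : vectType K;
  tens : forall i : 'I_r, tensor space (t i).1 (t i).2
}.

Definition dsum (S1 S2 : algstr) : algstr :=
  Algstr (fun i => dsum_tensor (tens S1 i) (tens S2 i)).

Definition tensprod (S1 S2 : algstr) : algstr :=
  Algstr (fun i => tprod_tensor (tens S1 i) (tens S2 i)).

Definition zero_str : algstr :=
  Algstr (fun i => @zero_tensor K 'rV[K]_0 (t i).1 (t i).2).

Definition one_str : algstr :=
  Algstr (fun i => one_tensor (t i).1 (t i).2).

(* The boxes of a diagram are 0, ..., n - 1; a string is a pair of a box b and the
   position of the string among the outputs, resp. the inputs, of b. *)
Definition outs n (lab : 'I_n -> 'I_r) := {b : 'I_n & 'I_((t (lab b)).1)}.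
Definition ins n (lab : 'I_n -> 'I_r) := {b : 'I_n & 'I_((t (lab b)).2)}.

Record diagram := Diagram {
  nbox : nat;
  lab : 'I_nbox -> 'I_r;
  conn : outs lab -> ins lab;
  conn_bij : bijective conn
}.

Definition out_str (D : diagram) (b : 'I_(nbox D)) (k : 'I_((t (lab b)).1)) :
  outs (@lab D) := existT _ b k.
Definition in_str (D : diagram) (b : 'I_(nbox D)) (k : 'I_((t (lab b)).2)) :
  ins (@lab D) := existT _ b k.

(* The contraction of the tensor product of the x_(lab b) along conn: l assigns a basis index to
   each input string, hence to each pair of connected strings. *)
Definition value (S : algstr) (D : diagram) : K :=
  \sum_(l : {ffun ins (@lab D) -> idx (space S)})
   \prod_(b < nbox D)
     tens S (lab b) [ffun k => cobas (l (conn (out_str k)))]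
                    [ffun k => bas (l (in_str k))].

Definition adjacent (D : diagram) : rel 'I_(nbox D) := fun b c =>
  [exists k : 'I_((t (lab b)).1), tag (conn (out_str k)) == c] ||
  [exists k : 'I_((t (lab c)).1), tag (conn (out_str k)) == b].

Definition connected (D : diagram) : Prop :=
  (0 < nbox D)%N /\ forall b c : 'I_(nbox D), connect (@adjacent D) b c.

Definition empty_conn (s : outs (@ord0_elim (fun=> 'I_r))) :
  ins (@ord0_elim (fun=> 'I_r)) := ord0_elim (fun=> _) (tag s).

Lemma empty_conn_bij : bijective empty_conn.
Proof. by exists (fun s => ord0_elim (fun=> _) (tag s)); case=> -[]. Qed.

Definition empty_diagram : diagram := Diagram empty_conn_bij.

Section Juxtaposition.
Variables D1 D2 : diagram.
Let n1 := nbox D1.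
Let n2 := nbox D2.

Definition sum_lab (s : 'I_n1 + 'I_n2) : 'I_r :=
  match s with inl b => lab b | inr c => lab c end.
Definition juxt_lab (b : 'I_(n1 + n2)) : 'I_r := sum_lab (split b).

Lemma juxt_labE s : sum_lab s = juxt_lab (unsplit s).
Proof. by rewrite /juxt_lab unsplitK. Qed.

Section Strings.
Variable w : 'I_r -> nat.

Definition tag_sum (u : 'I_n1 + 'I_n2) :
    'I_(w (sum_lab u)) ->
    {b : 'I_n1 & 'I_(w (lab b))} + {c : 'I_n2 & 'I_(w (lab c))} :=
  match u with
  | inl b => fun k => inl (existT _ b k)
  | inr c => fun k => inr (existT _ c k)
  end.

Definition split_str (s : {b : 'I_(n1 + n2) & 'I_(w (juxt_lab b))}) :
    {b : 'I_n1 & 'I_(w (lab b))} + {c : 'I_n2 & 'I_(w (lab c))} :=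
  @tag_sum (split (tag s)) (tagged s).

Definition unsplit_str
    (s : {b : 'I_n1 & 'I_(w (lab b))} + {c : 'I_n2 & 'I_(w (lab c))}) :
    {b : 'I_(n1 + n2) & 'I_(w (juxt_lab b))} :=
  match s with
  | inl (existT b k) => existT _ (unsplit (inl b))
      (cast_ord (congr1 w (juxt_labE (inl b))) k)
  | inr (existT c k) => existT _ (unsplit (inr c))
      (cast_ord (congr1 w (juxt_labE (inr c))) k)
  end.

Lemma str_eq n (f : 'I_n -> nat) (b c : 'I_n) (k : 'I_(f b)) (l : 'I_(f c)) :
  b = c -> k = l :> nat -> existT (fun b => 'I_(f b)) b k = existT _ c l.
Proof. by move=> e; case: c / e l => l /val_inj ->. Qed.

Lemma tag_sum_eq (u v : 'I_n1 + 'I_n2) (k : 'I_(w (sum_lab u)))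
    (l : 'I_(w (sum_lab v))) :
  u = v -> k = l :> nat -> tag_sum k = tag_sum l.
Proof. by move=> e; case: v / e l => l /val_inj ->. Qed.

Lemma unsplit_tag_sum (u : 'I_n1 + 'I_n2) (k : 'I_(w (sum_lab u))) :
  unsplit_str (tag_sum k) =
  existT _ (unsplit u) (cast_ord (congr1 w (juxt_labE u)) k).
Proof. by case: u k. Qed.

Lemma split_strK : cancel split_str unsplit_str.
Proof.
case=> b k; rewrite /split_str unsplit_tag_sum /=.
by apply: str_eq => //; apply: splitK.
Qed.

Lemma unsplit_strK : cancel unsplit_str split_str.
Proof.
case=> -[b k]; rewrite /split_str /=.
  have -> : inl (existT _ b k) = @tag_sum (inl b) k by [].
  by apply: tag_sum_eq => //; apply: (unsplitK (inl b)).
have -> : inr (existT _ b k) = @tag_sum (inr b) k by [].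
by apply: tag_sum_eq => //; apply: (unsplitK (inr b)).
Qed.
End Strings.

Definition sum_conn (s : outs (@lab D1) + outs (@lab D2)) :
    ins (@lab D1) + ins (@lab D2) :=
  match s with inl s => inl (conn s) | inr s => inr (conn s) end.

Definition juxt_conn (s : outs juxt_lab) : ins juxt_lab :=
  unsplit_str (w := fun i => (t i).2)
    (sum_conn (split_str (w := fun i => (t i).1) s)).

Lemma juxt_conn_bij : bijective juxt_conn.
Proof.
apply: (bij_comp (f := unsplit_str (w := fun i => (t i).2))
  (h := sum_conn \o split_str (w := fun i => (t i).1))).
  by exists (split_str (w := fun i => (t i).2)); [apply: unsplit_strK | apply: split_strK].
apply: bij_comp; last first.
  by exists (unsplit_str (w := fun i => (t i).1)); [apply: split_strK | apply: unsplit_strK].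
have [g1 c1K g1K] := conn_bij D1; have [g2 c2K g2K] := conn_bij D2.
exists (fun s => match s with inl s => inl (g1 s) | inr s => inr (g2 s) end).
  by case=> s /=; rewrite ?c1K ?c2K.
by case=> s /=; rewrite ?g1K ?g2K.
Qed.

Definition juxt : diagram := Diagram juxt_conn_bij.

Lemma tens_eq S (i j : 'I_r) phi phi' w w' :
  i = j ->
  (forall (k : 'I_(t i).1) (l : 'I_(t j).1), k = l :> nat -> phi k = phi' l) ->
  (forall (k : 'I_(t i).2) (l : 'I_(t j).2), k = l :> nat -> w k = w' l) ->
  tens S i (finfun phi) (finfun w) = tens S j (finfun phi') (finfun w').
Proof.
move=> e; case: j / e phi' w' => phi' w' ephi ew.
by congr (tens _ _ _ _); apply/ffunP => k; rewrite !ffunE; [apply: ephi|apply: ew].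
Qed.

Lemma value_juxt S : value S juxt = value S D1 * value S D2.
Proof.
rewrite /value big_distrlr /= pair_big /=.
pose glue (l : {ffun ins (@lab D1) -> idx (space S)} *
               {ffun ins (@lab D2) -> idx (space S)}) :
    {ffun ins juxt_lab -> idx (space S)} :=
  [ffun s => match split_str (w := fun i => (t i).2) s with
             | inl s => l.1 s | inr s => l.2 s end].
have glue_unsplit l s : glue l (unsplit_str (w := fun i => (t i).2) s) =
    match s with inl s => l.1 s | inr s => l.2 s end.
  by rewrite ffunE unsplit_strK.
rewrite (reindex glue); last first.
  apply: onW_bij.
  exists (fun l : {ffun ins juxt_lab -> idx (space S)} =>
    ([ffun s => l (unsplit_str (w := fun i => (t i).2) (inl s))],
     [ffun s => l (unsplit_str (w := fun i => (t i).2) (inr s))])).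
    by case=> l1 l2; congr pair; apply/ffunP => s; rewrite ffunE glue_unsplit.
  move=> l; apply/ffunP => s; rewrite ffunE -[in RHS](split_strK (w := fun i => (t i).2) s).
  by case: (split_str _) => s'; rewrite ffunE.
apply: eq_bigr => l _; rewrite big_split_ord /=; congr (_ * _).
  apply: eq_bigr => b _; have e : juxt_lab (lshift n2 b) = lab b.
    by rewrite -(juxt_labE (inl b)).
  apply: tens_eq => // k k' ek.
    rewrite -(glue_unsplit l (inl (conn (out_str k')))); congr (cobas (glue l _)).
    apply: (congr1 (fun s => unsplit_str (w := fun i => (t i).2) (sum_conn s))
      (y := inl (out_str k'))).
    rewrite -(unsplit_strK (w := fun i => (t i).1) (inl (out_str k'))).
    by congr split_str; apply: str_eq.
  rewrite -(glue_unsplit l (inl (in_str k'))); congr (bas (glue l _)).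
  exact: str_eq.
apply: eq_bigr => b _; have e : juxt_lab (rshift n1 b) = lab b.
  by rewrite -(juxt_labE (inr b)).
apply: tens_eq => // k k' ek.
  rewrite -(glue_unsplit l (inr (conn (out_str k')))); congr (cobas (glue l _)).
  apply: (congr1 (fun s => unsplit_str (w := fun i => (t i).2) (sum_conn s))
    (y := inr (out_str k'))).
  rewrite -(unsplit_strK (w := fun i => (t i).1) (inr (out_str k'))).
  by congr split_str; apply: str_eq.
rewrite -(glue_unsplit l (inr (in_str k'))); congr (bas (glue l _)).
exact: str_eq.
Qed.
End Juxtaposition.

Lemma value_nobox S D : nbox D = 0%N -> value S D = 1.
Proof.
case: D => n lb c cb /= n0; rewrite /value /=; subst n.
under eq_bigr do rewrite big_ord0.
have e0 : #|{: ins lb}| = 0%N by apply: eq_card0 => -[[]].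
by rewrite sumr_const card_ffun e0 expn0.
Qed.

Lemma value_zero_str D : (0 < nbox D)%N -> value zero_str D = 0.
Proof.
case: D => -[|n] lb c cb //= _; rewrite /value /=.
by rewrite big1 // => l _; rewrite big_ord_recl mul0r.
Qed.

Definition equiv_diagram (D1 D2 : diagram) : bool :=
  `[< forall S : algstr, value S D1 = value S D2 >].

Lemma equiv_diagramP D1 D2 :
  reflect (forall S, value S D1 = value S D2) (equiv_diagram D1 D2).
Proof. exact: asboolP. Qed.

HB.instance Definition _ := gen_eqMixin diagram.
HB.instance Definition _ := gen_choiceMixin diagram.

Lemma equiv_refl : reflexive equiv_diagram.
Proof. by move=> D; apply/equiv_diagramP. Qed.
Lemma equiv_sym : symmetric equiv_diagram.
Proof. by move=> D E; apply/equiv_diagramP/equiv_diagramP => h S. Qed.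
Lemma equiv_trans : transitive equiv_diagram.
Proof.
move=> D E F /equiv_diagramP h /equiv_diagramP h'.
by apply/equiv_diagramP => S; rewrite h.
Qed.

Canonical equiv_diagram_rel :=
  EquivRel equiv_diagram equiv_refl equiv_sym equiv_trans.

Definition dclass := {eq_quot equiv_diagram_rel}.
HB.instance Definition _ := Choice.on dclass.
HB.instance Definition _ := EqQuotient.on dclass.

Definition cls (D : diagram) : dclass := \pi_dclass D.
Definition cval (S : algstr) (m : dclass) : K := value S (repr m).

Lemma cvalE S D : cval S (cls D) = value S D.
Proof.
rewrite /cval /cls; apply: (equiv_diagramP _ _ _).
by apply/eqmodP; rewrite reprK.
Qed.

Lemma clsP D1 D2 : cls D1 = cls D2 <-> forall S, value S D1 = value S D2.
Proof.
split=> [e S|h]; first by rewrite -!cvalE e.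
by apply/eqmodP/equiv_diagramP.
Qed.

Lemma dclassP (m1 m2 : dclass) : (forall S, cval S m1 = cval S m2) -> m1 = m2.
Proof. by move=> h; rewrite -[m1]reprK -[m2]reprK; apply/clsP. Qed.

Definition dclass_one : dclass := cls empty_diagram.
Definition dclass_mul (m1 m2 : dclass) : dclass := cls (juxt (repr m1) (repr m2)).

Lemma cval_one S : cval S dclass_one = 1.
Proof. by rewrite cvalE value_nobox. Qed.

Lemma cval_mul S m1 m2 : cval S (dclass_mul m1 m2) = cval S m1 * cval S m2.
Proof. by rewrite cvalE value_juxt. Qed.

Lemma cls_juxt D1 D2 : cls (juxt D1 D2) = dclass_mul (cls D1) (cls D2).
Proof. by apply: dclassP => S; rewrite cval_mul !cvalE value_juxt. Qed.

Lemma dclass_mulA : associative dclass_mul.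
Proof. by move=> x y z; apply: dclassP => S; rewrite !cval_mul mulrA. Qed.
Lemma dclass_mulC : commutative dclass_mul.
Proof. by move=> x y; apply: dclassP => S; rewrite !cval_mul mulrC. Qed.
Lemma dclass_mul1m : left_id dclass_one dclass_mul.
Proof. by move=> x; apply: dclassP => S; rewrite cval_mul cval_one mul1r. Qed.
Lemma dclass_mulm1 : right_id dclass_one dclass_mul.
Proof. by move=> x; rewrite dclass_mulC dclass_mul1m. Qed.

Lemma dclass_unitm m1 m2 :
  dclass_mul m1 m2 = dclass_one -> m1 = dclass_one /\ m2 = dclass_one.
Proof.
have one0 m : cval zero_str m != 0 -> m = dclass_one.
  move=> nz; apply: dclassP => S; rewrite cval_one /cval value_nobox //.
  by apply/eqP; rewrite -leqn0 leqNgt; apply: contra nz => /value_zero_str/eqP.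
move=> e; have : cval zero_str m1 * cval zero_str m2 != 0.
  by rewrite -cval_mul e cval_one oner_neq0.
by rewrite mulf_eq0 negb_or => /andP[h1 h2]; split; apply: one0.
Qed.

HB.instance Definition _ := Choice_isMonomialDef.Build dclass
  dclass_mulA dclass_mul1m dclass_mulm1 dclass_unitm.
HB.instance Definition _ := MonomialDef_isConomialDef.Build dclass dclass_mulC.

(* K[X] is {malg K[dclass]}: the monomial law on dclass is juxtaposition. *)
Definition diag (D : diagram) : {malg K[dclass]} := << cls D >>.

Lemma diag_empty : diag empty_diagram = 1.
Proof. by []. Qed.
Lemma diag_juxt D1 D2 : diag (juxt D1 D2) = diag D1 * diag D2.
Proof. by rewrite /diag cls_juxt malgM_def fgmulUU mulr1. Qed.

Definition eval (f : {malg K[dclass]}) (S : algstr) : K :=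
  lext (fun m => cval S m : K^o) f.

(* \sum_j f_j' (S1) f_j'' (S2) for T = \sum_j f_j' \ot f_j''. *)
Definition eval2 (T : {malg K[(dclass * dclass)%type]}) (S1 S2 : algstr) : K :=
  lext (fun m : (dclass * dclass)%type => cval S1 m.1 * cval S2 m.2 : K^o) T.

Definition induces (op : algstr -> algstr -> algstr)
    (Delta : {malg K[dclass]} -> {malg K[(dclass * dclass)%type]}) : Prop :=
  linear Delta /\
  forall f S1 S2, eval2 (Delta f) S1 S2 = eval f (op S1 S2).

Definition counit_dsum (f : {malg K[dclass]}) : K := eval f zero_str.
Definition counit_tensprod (f : {malg K[dclass]}) : K := eval f one_str.

End Structures.

(* Main.v *)
Require Import Defs.
From HB Require Import structures.
From mathcomp Require Import all_boot all_algebra.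
From mathcomp Require Import boolp.
From mathcomp Require Import finmap monalg.

Set Implicit Arguments.
Unset Strict Implicit.
Unset Printing Implicit Defensive.

Import GRing.Theory.
Local Open Scope ring_scope.

(* A contraction can be computed with any resolution of the identity of W. The evident ones
   for W1 (x) W2 and W1 (+) W2 show that the value of a diagram is multiplicative in the
   tensor product of structures and, on connected diagrams, additive in the direct sum: in
   the latter case all contributions mixing the two summands contain a zero vector or
   covector. Hence classes of diagrams are pairwise distinct characters of the semigroup of
   structures under (x), and by Dedekind's lemma they are linearly independent: an element of
   K[X], K[X] (x) K[X], ... is determined by its values. This gives the uniqueness of the
   coproducts and reduces the bialgebra axioms to identities between values. Every diagram is
   a disjoint union of connected ones p, and Delta is the corresponding product of the
   p (x) 1 + 1 (x) p; the antipode multiplies a diagram with k components by (-1)^k, and k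
   depends only on the class of the diagram since 2^k is its value on the direct sum of two
   copies of (K, (1)) and char K = 0. *)

(** * Contractions and resolutions of the identity *)

Section MultilinearForms.
Variables (K : closedFieldType) (V : lmodType K) (T : finType).

Definition fupd (A : Type) (f : {ffun T -> A}) (s : T) (u : A) : {ffun T -> A} :=
  [ffun s' => if s' == s then u else f s'].

(** Transports [multilinear_expand] along an enumeration of [T]; the strings of a diagram form such
    a [T]. *)
Lemma multilinear_expand_fin (I : finType) (e : I -> V) (g : {ffun T -> V} -> K)
    (c : T -> I -> K) :
  (forall f s, scalar (fun u => g (fupd f s u))) ->
  g [ffun s => \sum_i c s i *: e i] =
  \sum_(a : {ffun T -> I}) (\prod_s c s (a s)) * g [ffun s => e (a s)].
Proof.
move=> lin_g.
pose g' (f : {ffun 'I_#|T| -> V}) := g [ffun s => f (enum_rank s)].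
have lin_g' f j : scalar (fun u => g' (upd f j u)).
  move=> a u v; have E w : [ffun s => upd f j w (enum_rank s)] =
      fupd [ffun s => f (enum_rank s)] (enum_val j) w.
    apply/ffunP => s; rewrite !ffunE.
    by rewrite -{1}(enum_valK j) (inj_eq enum_rank_inj).
  by rewrite /g' !E lin_g.
have := multilinear_expand e (fun k => c (enum_val k)) lin_g'.
have -> : g' [ffun k => \sum_i c (enum_val k) i *: e i] =
    g [ffun s => \sum_i c s i *: e i].
  by congr g; apply/ffunP => s; rewrite !ffunE enum_rankK.
move=> ->; rewrite (reindex (fun a : {ffun T -> I} => [ffun k => a (enum_val k)])) /=.
  apply: eq_bigr => a _; congr (_ * _).
    rewrite [RHS](reindex (@enum_val T predT)); last by apply: onW_bij; apply: enum_val_bij.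
    by apply: eq_bigr => k _; rewrite ffunE.
  by congr g; apply/ffunP => s; rewrite !ffunE enum_rankK.
apply: onW_bij; exists (fun a : {ffun 'I_#|T| -> I} => [ffun s => a (enum_rank s)]).
  by move=> a; apply/ffunP => s; rewrite !ffunE enum_rankK.
by move=> a; apply/ffunP => k; rewrite !ffunE enum_valK.
Qed.
End MultilinearForms.

Section TensorZero.
Variables (K : closedFieldType) (W : vectType K) (p q : nat) (x : tensor W p q).

Lemma tensor_zerol (phi : {ffun 'I_p -> dual W}) w k : phi k = 0 -> x phi w = 0.
Proof.
move=> phik; have -> : phi = upd phi k 0.
  by apply/ffunP => j; rewrite ffunE; case: eqP => // ->.
by have := tensor_linl x phi w k (-1) 0 0; rewrite scaler0 addr0 mulN1r addNr.
Qed.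

Lemma tensor_zeror phi (w : {ffun 'I_q -> W}) k : w k = 0 -> x phi w = 0.
Proof.
move=> wk; have -> : w = upd w k 0.
  by apply/ffunP => j; rewrite ffunE; case: eqP => // ->.
by have := tensor_linr x phi w k (-1) 0 0; rewrite scaler0 addr0 mulN1r addNr.
Qed.
End TensorZero.

Section Contraction.
Variables (K : closedFieldType) (r : nat) (t : 'I_r -> nat * nat).
Variables (S : algstr K t) (D : diagram t).
Let W := Defs.space S.

(** Covectors too are indexed by input strings: the output string [s] receives [psi (conn s)]. With
    [psi] and [w] independent, this is a multilinear form whose trace is the value of the
    diagram. *)
Definition boxes_value (psi : {ffun ins t (@lab _ _ D) -> dual W})
    (w : {ffun ins t (@lab _ _ D) -> W}) : K :=
  \prod_b tens S (lab b) [ffun k => psi (conn (out_str k))] [ffun k => w (in_str k)].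

Lemma boxes_value_linr psi w s : scalar (fun u => boxes_value psi (fupd w s u)).
Proof.
case: s => b0 k0 a u v; rewrite /boxes_value !(bigD1 (P := predT) b0) //=.
set s := existT _ _ _.
have E0 u' : [ffun k => fupd w s u' (in_str k)] =
    upd [ffun k : 'I_(t (lab b0)).2 => w (in_str k)] k0 u'.
  by apply/ffunP => k; rewrite !ffunE eq_Tagged.
have E1 u' : \prod_(b | b != b0) tens S (lab b) [ffun k => psi (conn (out_str k))]
      [ffun k => fupd w s u' (in_str k)] =
    \prod_(b | b != b0) tens S (lab b) [ffun k => psi (conn (out_str k))]
      [ffun k => w (in_str k)].
  apply: eq_bigr => b nb; congr (tens _ _ _ _); apply/ffunP => k; rewrite !ffunE.
  by case: eqP => // /(congr1 tag) /= e; rewrite e eqxx in nb.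
by rewrite !E0 !E1 tensor_linr mulrDl mulrA.
Qed.

Lemma boxes_value_linl psi w s : scalar (fun u => boxes_value (fupd psi s u) w).
Proof.
(* Since [conn] is bijective, [s] is fed by exactly one output string, so a change of [psi] at [s]
   affects the box [b0] alone. *)
have [g gK Kg] := conn_bij D; rewrite -(Kg s); case: (g s) => b0 k0 a u v.
rewrite /boxes_value !(bigD1 (P := predT) b0) //=.
set s0 := existT _ _ _.
have E0 u' : [ffun k => fupd psi (conn s0) u' (conn (out_str k))] =
    upd [ffun k : 'I_(t (lab b0)).1 => psi (conn (out_str k))] k0 u'.
  by apply/ffunP => k; rewrite !ffunE (inj_eq (can_inj gK)) eq_Tagged.
have E1 u' : \prod_(b | b != b0) tens S (lab b)
      [ffun k => fupd psi (conn s0) u' (conn (out_str k))] [ffun k => w (in_str k)] =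
    \prod_(b | b != b0) tens S (lab b) [ffun k => psi (conn (out_str k))]
      [ffun k => w (in_str k)].
  apply: eq_bigr => b nb; congr (tens _ _ _ _); apply/ffunP => k; rewrite !ffunE.
  rewrite (inj_eq (can_inj gK)).
  by case: eqP => // /(congr1 tag) /= e; rewrite e eqxx in nb.
by rewrite !E0 !E1 tensor_linl mulrDl mulrA.
Qed.

(* [\sum_j e j (x) e' j] is the identity of [W], seen in [W (x) W^*]; [J] may be
   larger than the dimension of [W]. *)
Definition frame (J : finType) (e : J -> W) (e' : J -> dual W) : Prop :=
  forall u, u = \sum_j (e' j u : K) *: e j.

(** Expanding each vector [e j] in the basis [bas] yields coefficients [cobas i (e j)]; moved to the
    covector slot, they recombine the [e' j] into [cobas i], because the frame property transposes
    to the dual. *)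
Lemma value_frame (J : finType) (e : J -> W) (e' : J -> dual W) : frame e e' ->
  value S D = \sum_(l : {ffun ins t (@lab _ _ D) -> J})
    \prod_b tens S (lab b) [ffun k => e' (l (conn (out_str k)))]
                           [ffun k => e (l (in_str k))].
Proof.
move=> fr.
have H (J' : finType) (f : J' -> W) (f' : J' -> dual W) :
  \sum_(l : {ffun ins t (@lab _ _ D) -> J'})
    \prod_b tens S (lab b) [ffun k => f' (l (conn (out_str k)))]
                           [ffun k => f (l (in_str k))] =
  \sum_(l : {ffun ins t (@lab _ _ D) -> J'})
    boxes_value [ffun s => f' (l s)] [ffun s => f (l s)].
  apply: eq_bigr => l _; apply: eq_bigr => b _.
  by congr (tens _ _ _ _); apply/ffunP => k; rewrite !ffunE.
rewrite /value !{}H.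
transitivity (\sum_(l : {ffun ins t (@lab _ _ D) -> J})
    \sum_(a : {ffun ins t (@lab _ _ D) -> idx W}) (\prod_s (cobas (a s) (e (l s)) : K)) *
      boxes_value [ffun s => e' (l s)] [ffun s => bas (a s)]); last first.
  apply: eq_bigr => l _.
  rewrite -(@multilinear_expand_fin _ _ _ _ _ _
    (fun s i => (cobas i (e (l s)) : K)) (@boxes_value_linr _)).
  by congr boxes_value; apply/ffunP => s; rewrite !ffunE -bas_expand.
rewrite exchange_big; apply: eq_bigr => a _ /=.
rewrite -(@multilinear_expand_fin _ _ _ _ _ (fun psi => boxes_value psi _)
    (fun s j => (cobas (a s) (e j) : K))); last by move=> f s; apply: boxes_value_linl.
congr boxes_value; apply/ffunP => s; rewrite !ffunE.
apply/lfunP => u; rewrite sum_lfunE {1}(fr u) linear_sum /=.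
by apply: eq_bigr => j _; rewrite linearZ scale_lfunE /= /GRing.scale /= mulrC.
Qed.
End Contraction.

(** * Values on direct sums and tensor products *)

Section Values.
Variables (K : closedFieldType) (r : nat) (t : 'I_r -> nat * nat).

Lemma value_one_str (D : diagram t) : value (one_str K t) D = 1.
Proof.
(* The vector 1 and the identity form are a one-element frame of K, so a single labelling
   remains. *)
rewrite (@value_frame _ _ _ (one_str K t) D unit (fun=> 1) (fun=> \1%VF)); last first.
  by move=> u; rewrite (big_pred1 tt) => [|[]] //; rewrite id_lfunE /GRing.scale /= mulr1.
rewrite (big_pred1 [ffun=> tt]) => [|l]; last first.
  by apply/esym/eqP/ffunP => s; rewrite ffunE; case: (l s).
rewrite big1 // => b _; rewrite /= /one_tapp !big1 ?mulr1 // => k _.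
  by rewrite ffunE.
by rewrite ffunE id_lfunE.
Qed.

(** In the frame of pure tensors of basis elements, a labelling is a pair of labellings, and
    [tprod_tensor_pure] splits the factor of each box. *)
Lemma value_tensprod (S1 S2 : algstr K t) (D : diagram t) :
  value (tensprod S1 S2) D = value S1 D * value S2 D.
Proof.
pose J := (idx (Defs.space S1) * idx (Defs.space S2))%type.
rewrite (@value_frame _ _ _ (tensprod S1 S2) D J
  (fun j => pure (bas j.1) (bas j.2)) (fun j => dpure (cobas j.1) (cobas j.2))).
  rewrite {1 2}/value big_distrlr /= pair_big /=.
  rewrite (reindex (fun z : {ffun ins t (@lab _ _ D) -> idx (Defs.space S1)} *
                            {ffun ins t (@lab _ _ D) -> idx (Defs.space S2)} =>
    [ffun s => (z.1 s, z.2 s)] : {ffun _ -> J})) /=; last first.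
    apply: onW_bij; exists (fun l : {ffun ins t (@lab _ _ D) -> J} =>
      ([ffun s => (l s).1], [ffun s => (l s).2])).
      by case=> l1 l2; congr pair; apply/ffunP => s; rewrite !ffunE.
    by move=> l; apply/ffunP => s; rewrite !ffunE /=; case: (l s).
  apply: eq_bigr => -[l1 l2] _ /=; rewrite -big_split; apply: eq_bigr => b _ /=.
  rewrite -[RHS]tprod_tensor_pure /=.
  by congr (tprod_tapp _ _ _ _); apply/ffunP => k; rewrite !ffunE.
(* The frame property: expand [phi] along [cobas], then each vector [u (cobas i)] along [bas]. *)
move=> u; apply/lfunP => phi.
rewrite sum_lfunE -(pair_bigA _ (fun i j =>
  ((dpure (cobas i) (cobas j) u : K) *: pure (bas i) (bas j)) phi)) /=.
rewrite {1}(cobas_expand phi) linear_sum /=; apply: eq_bigr => i _.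
rewrite linearZ /= {1}(bas_expand (u (cobas i))) scaler_sumr; apply: eq_bigr => j _.
rewrite scale_lfunE pureE !scalerA; congr (_ *: _); rewrite mulrC; congr (_ * _).
by rewrite [RHS]linfunE // => a f g; rewrite add_lfunE scale_lfunE linearP.
Qed.

Lemma prodr_eq0 (I : finType) (F : I -> K) i : F i = 0 -> \prod_j F j = 0.
Proof. by move=> F0; rewrite (bigD1 i) //= F0 mul0r. Qed.

Lemma value_dsum_connected (S1 S2 : algstr K t) (D : diagram t) : connected D ->
  value (dsum S1 S2) D = value S1 D + value S2 D.
Proof.
case=> D_gt0 D_conn; pose W1 := Defs.space S1; pose W2 := Defs.space S2.
(* Padding the bases of both summands with zeros gives frames of [W1], [W2] and their sum over the
   same index type, so that all three values are sums over the same labellings. *)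
pose J := (idx W1 + idx W2)%type.
pose e1 (j : J) : W1 := if j is inl i then bas i else 0.
pose e2 (j : J) : W2 := if j is inr i then bas i else 0.
pose e1' (j : J) : dual W1 := if j is inl i then cobas i else 0.
pose e2' (j : J) : dual W2 := if j is inr i then cobas i else 0.
pose e (j : J) : (W1 * W2)%type := (e1 j, e2 j).
pose e' (j : J) : dual (W1 * W2)%type :=
  linfun (fun u : (W1 * W2)%type => e1' j u.1 + e2' j u.2 : K^o).
have e'E j u : e' j u = e1' j u.1 + e2' j u.2.
  by rewrite linfunE // => a f g /=; rewrite !linearP /= scalerDr addrACA.
have sumJ (U : nmodType) (F : J -> U) :
    \sum_j F j = \sum_i F (inl i) + \sum_i F (inr i) by exact: big_sumType.
have fr1 : frame e1 e1'.
  move=> u; rewrite sumJ /= [X in _ + X]big1 => [|i _]; last by rewrite scaler0.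
  by rewrite addr0 -bas_expand.
have fr2 : frame e2 e2'.
  move=> u; rewrite sumJ /= [X in X + _]big1 => [|i _]; last by rewrite scaler0.
  by rewrite add0r -bas_expand.
have fr : @frame _ _ _ (dsum S1 S2) J e e'.
  move=> u; have fstD : {morph @fst W1 W2 : v w / v + w} by [].
  have sndD : {morph @snd W1 W2 : v w / v + w} by [].
  have fst0 : fst (0 : (W1 * W2)%type) = 0 by [].
  have snd0 : snd (0 : (W1 * W2)%type) = 0 by [].
  rewrite [RHS]surjective_pairing (big_morph _ fstD fst0) (big_morph _ sndD snd0) /=.
  rewrite [LHS]surjective_pairing; congr pair.
    rewrite [LHS]fr1; apply: eq_bigr => -[i|i] _; rewrite ?scaler0 //=.
    by rewrite e'E /= zero_lfunE addr0.
  rewrite [LHS]fr2; apply: eq_bigr => -[i|i] _; rewrite ?scaler0 //=.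
  by rewrite e'E /= zero_lfunE add0r.
have restlE j : restl (e' j) = e1' j.
  by apply/lfunP => u; rewrite comp_lfunE injlE e'E /= linear0 addr0.
have restrE j : restr (e' j) = e2' j.
  by apply/lfunP => u; rewrite comp_lfunE injrE e'E /= linear0 add0r.
pose X (l : {ffun ins t (@lab _ _ D) -> J}) b :=
  tens S1 (lab b) [ffun k => e1' (l (conn (out_str k)))] [ffun k => e1 (l (in_str k))].
pose Y (l : {ffun ins t (@lab _ _ D) -> J}) b :=
  tens S2 (lab b) [ffun k => e2' (l (conn (out_str k)))] [ffun k => e2 (l (in_str k))].
rewrite (value_frame _ fr) (value_frame _ fr1) (value_frame _ fr2).
(* Each box contributes a sum of two terms; [B] records the choice made at every box, [true]
   standing for the first summand. Only the two constant choices will survive. *)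
transitivity (\sum_l \sum_(B : {ffun 'I_(nbox D) -> bool})
    \prod_b (if B b then X l b else Y l b)).
  apply: eq_bigr => l _.
  rewrite -(bigA_distr_bigA (fun b (c : bool) => if c then X l b else Y l b)).
  apply: eq_bigr => b _; rewrite big_bool /= /dsum_tapp; congr (_ + _).
    by congr (tens _ _ _ _); apply/ffunP => k; rewrite !ffunE.
  by congr (tens _ _ _ _); apply/ffunP => k; rewrite !ffunE.
rewrite exchange_big (bigD1 [ffun=> true]) //=; congr (_ + _).
  by apply: eq_bigr => l _; apply: eq_bigr => b _; rewrite ffunE.
have ntf : [ffun=> false] != [ffun=> true] :> {ffun 'I_(nbox D) -> bool}.
  by apply/eqP => /ffunP/(_ (Ordinal D_gt0)); rewrite !ffunE.
rewrite (bigD1 [ffun=> false]) //= [X in _ + X]big1 => [|B /andP[Bt Bf]].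
  by rewrite addr0; apply: eq_bigr => l _; apply: eq_bigr => b _; rewrite ffunE.
(* Otherwise [B] would be constant along edges, hence constant by connectedness. *)
have [s Bs] : exists s : outs t (@lab _ _ D), B (tag s) != B (tag (conn s)).
  apply: contrapT => /forallNP noB.
  have B_closed : closed (@adjacent _ _ D) [pred b | B b].
    have noB' s : B (tag s) = B (tag (conn s)).
      by apply/eqP/negP => /negP/(noB s).
    move=> b c /orP[] /existsP[k /eqP e0]; rewrite !inE -e0.
      exact: (noB' (out_str k)).
    exact/esym/(noB' (out_str k)).
  have B_const b : B b = B (Ordinal D_gt0).
    exact: (closed_connect B_closed (D_conn _ _)).
  case: (boolP (B (Ordinal D_gt0))) => B0.
    by case/eqP: Bt; apply/ffunP => b; rewrite ffunE B_const B0.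
  by case/eqP: Bf; apply/ffunP => b; rewrite ffunE B_const (negPf B0).
(* The label of the string from [b] to [c] lies in one summand, while one of these two boxes takes
   its tensor from the other summand and thus sees a zero covector or vector. *)
apply: big1 => l _; case: s Bs => b k; case Es: (conn _) => [c k'] /=.
have lin : in_str k' = conn (out_str k) by rewrite /out_str Es.
have Xb : e1' (l (conn (out_str k))) = 0 -> X l b = 0.
  by move=> z; apply: (@tensor_zerol _ _ _ _ _ _ _ k); rewrite ffunE.
have Yb : e2' (l (conn (out_str k))) = 0 -> Y l b = 0.
  by move=> z; apply: (@tensor_zerol _ _ _ _ _ _ _ k); rewrite ffunE.
have Xc : e1 (l (conn (out_str k))) = 0 -> X l c = 0.
  by move=> z; apply: (@tensor_zeror _ _ _ _ _ _ _ k'); rewrite ffunE lin.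
have Yc : e2 (l (conn (out_str k))) = 0 -> Y l c = 0.
  by move=> z; apply: (@tensor_zeror _ _ _ _ _ _ _ k'); rewrite ffunE lin.
case: (l _) Xb Yb Xc Yc => i /= Xb Yb Xc Yc; case Bb: (B b); case Bc: (B c) => // _.
- by apply: (@prodr_eq0 _ _ c); rewrite Bc Yc.
- by apply: (@prodr_eq0 _ _ b); rewrite Bb Yb.
- by apply: (@prodr_eq0 _ _ b); rewrite Bb Xb.
- by apply: (@prodr_eq0 _ _ c); rewrite Bc Xc.
Qed.
End Values.

(** * Decomposition into connected diagrams *)

Lemma prod_sum_ffun (K : comNzRingType) (I J J1 J2 : finType) (F : J1 + J2 -> J)
    (G1 : {ffun J1 -> I} -> K) (G2 : {ffun J2 -> I} -> K) : bijective F ->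
  \sum_(l : {ffun J -> I}) G1 [ffun s => l (F (inl s))] * G2 [ffun s => l (F (inr s))] =
  (\sum_l G1 l) * (\sum_l G2 l).
Proof.
case=> h FK hK; rewrite big_distrlr /= pair_big /=.
rewrite [RHS](reindex (fun l : {ffun J -> I} =>
  ([ffun s => l (F (inl s))], [ffun s => l (F (inr s))]))) //=.
apply: onW_bij; exists (fun l : {ffun J1 -> I} * {ffun J2 -> I} =>
  [ffun s => match h s with inl s => l.1 s | inr s => l.2 s end]).
  move=> l; apply/ffunP => s; rewrite ffunE /=.
  by case E: (h s) => [s'|s']; rewrite ffunE -E hK.
by case=> l1 l2; congr pair; apply/ffunP => s; rewrite !ffunE FK.
Qed.

Section SubDiagram.
Variables (r : nat) (t : 'I_r -> nat * nat) (D : diagram t) (A : {set 'I_(nbox D)}).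

Definition sub_lab (i : 'I_#|A|) : 'I_r := lab (enum_val i).

(** The position is reused without a cast, as [sub_lab i] unfolds to the label of [enum_val i]. The
    parameter [w] serves outputs and inputs alike. *)
Definition sub_str (w : 'I_r -> nat) (s : {i : 'I_#|A| & 'I_(w (sub_lab i))}) :
  {b : 'I_(nbox D) & 'I_(w (lab b))} := existT _ (enum_val (tag s)) (tagged s).

Lemma sub_str_inj w : injective (@sub_str w).
Proof.
case=> i k [j l] e; have eij := enum_val_inj (congr1 tag e); rewrite /= in eij.
by subst j; congr existT; apply/eqP; move/eqP: e; rewrite /sub_str eq_Tagged.
Qed.

Lemma sub_str_in w s : tag (@sub_str w s) \in A.
Proof. exact: enum_valP. Qed.

Lemma sub_str_onto w (s : {b : 'I_(nbox D) & 'I_(w (lab b))}) :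
  tag s \in A -> exists s', @sub_str w s' = s.
Proof.
case: s => b k /= bA; rewrite -(enum_rankK_in bA bA) in k *.
by exists (existT _ (enum_rank_in bA b) k).
Qed.

Hypothesis A_closed : forall s, (tag (@conn _ _ D s) \in A) = (tag s \in A).

(** The map [sub_str] identifies the strings of the subdiagram with those attached to [A]. Read in
    its two directions, closedness makes [conn] map these outputs into, and onto, these inputs. *)
Lemma sub_conn_exists : exists c : outs t sub_lab -> ins t sub_lab,
  bijective c /\
  forall s, sub_str (w := fun i => (t i).2) (c s) =
            conn (sub_str (w := fun i => (t i).1) s).
Proof.
have /boolp.choice[c cE] : forall s : outs t sub_lab, exists s' : ins t sub_lab,
    sub_str (w := fun i => (t i).2) s' = conn (sub_str (w := fun i => (t i).1) s).
  move=> s; apply: (@sub_str_onto (fun i => (t i).2)).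
  by rewrite A_closed sub_str_in.
exists c; split=> //; have [g gK Kg] := conn_bij D.
have c_inj : injective c.
  move=> s s' /(congr1 (@sub_str (fun i => (t i).2))).
  by rewrite !cE => /(can_inj gK)/sub_str_inj.
have /boolp.choice[h hK] : forall s, exists s', c s' = s.
  move=> s; have [|s' s'E] := @sub_str_onto (fun i => (t i).1)
      (g (sub_str (w := fun i => (t i).2) s)).
    by rewrite -A_closed Kg sub_str_in.
  by exists s'; apply: (@sub_str_inj (fun i => (t i).2)); rewrite cE s'E Kg.
by exists h => // s; apply: c_inj; rewrite hK.
Qed.

Definition sub_diagram : diagram t := Diagram (projT2 (cid sub_conn_exists)).1.

Lemma sub_connE (s : outs t (@lab _ _ sub_diagram)) :
  sub_str (w := fun i => (t i).2) (conn s) = conn (sub_str (w := fun i => (t i).1) s).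
Proof. exact: (projT2 (cid sub_conn_exists)).2. Qed.

End SubDiagram.

Section Decomposition.
Variables (K : closedFieldType) (r : nat) (t : 'I_r -> nat * nat).

(** No string joins [A] to its complement, so both the labellings and the product over boxes
    split. *)
Lemma value_sub_diagram (S : algstr K t) (D : diagram t) (A : {set 'I_(nbox D)})
    (clA : forall s, (tag (@conn _ _ D s) \in A) = (tag s \in A))
    (clAC : forall s, (tag (@conn _ _ D s) \in ~: A) = (tag s \in ~: A)) :
  value S D = value S (sub_diagram clA) * value S (sub_diagram clAC).
Proof.
pose F (s : ins t (@sub_lab _ _ D A) + ins t (@sub_lab _ _ D (~: A))) :
    ins t (@lab _ _ D) :=
  match s with
  | inl s => sub_str (w := fun i => (t i).2) s
  | inr s => sub_str (w := fun i => (t i).2) s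
  end.
have F_bij : bijective F.
  have F_inj : injective F.
    have disj (s : ins t (@sub_lab _ _ D A)) (s' : ins t (@sub_lab _ _ D (~: A))) :
        F (inl s) <> F (inr s').
      move=> /(congr1 tag) e; have := sub_str_in (w := fun i => (t i).2) s'.
      by rewrite -[tag _]e inE (sub_str_in (w := fun i => (t i).2) s).
    case=> s [] s' e; last 1 first.
    - by congr inr; apply: (sub_str_inj (w := fun i => (t i).2)).
    - by congr inl; apply: (sub_str_inj (w := fun i => (t i).2)).
    - by case: (disj _ _ e).
    - by case: (disj _ _ (esym e)).
  have /boolp.choice[h hK] : forall s, exists s', F s' = s.
    move=> s; have [sA|sA] := boolP (tag s \in A).
      by have [s' <-] := sub_str_onto (w := fun i => (t i).2) sA; exists (inl s').
    rewrite -in_setC in sA.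
    by have [s' <-] := sub_str_onto (w := fun i => (t i).2) sA; exists (inr s').
  by exists h => // s; apply: F_inj; rewrite hK.
rewrite /value -(prod_sum_ffun _ _ F_bij); apply: eq_bigr => l _.
rewrite (bigID (mem A)) /=; congr (_ * _).
  rewrite big_enum_val; apply: eq_bigr => i _.
  congr (tens _ _ _ _); apply/ffunP => k; rewrite !ffunE //.
  by congr (cobas (l _)); apply/esym/(sub_connE (out_str (D := sub_diagram clA) k)).
under eq_bigl do rewrite -in_setC.
rewrite big_enum_val; apply: eq_bigr => i _.
congr (tens _ _ _ _); apply/ffunP => k; rewrite !ffunE //.
by congr (cobas (l _)); apply/esym/(sub_connE (out_str (D := sub_diagram clAC) k)).
Qed.

(** Strong induction on the number of boxes. Comparing values suffices, since they determine the
    class of a diagram. *)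
Lemma connected_decomposition (D : diagram t) :
  exists s : seq (diagram t), (forall p, p \in s -> connected p) /\
    forall S : algstr K t, value S D = \prod_(p <- s) value S p.
Proof.
have [n le_n] := ubnP (nbox D); elim: n D le_n => // n IHn D le_n.
case: (posnP (nbox D)) => [D0|D_gt0].
  by exists [::]; split=> // S; rewrite big_nil value_nobox.
have [Dc|] := pselect (connected D).
  by exists [:: D]; split=> [p|S]; rewrite ?big_seq1 // inE => /eqP->.
move=> nDc; have {nDc} [b [c nbc]] : exists b c, ~~ connect (@adjacent _ _ D) b c.
  apply: contrapT => h; apply: nDc; split=> // b c; apply/negP => /negP nbc.
  by apply: h; exists b, c.
(* The component of [b] contains [b] but not [c], so it and its complement both have fewer boxes
   than [D]. *)
pose A := [set d | connect (@adjacent _ _ D) b d].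
have clA s : (tag (@conn _ _ D s) \in A) = (tag s \in A).
  have sc : adjacent (tag s) (tag (conn s)).
    by case: s => d k; apply/orP; left; apply/existsP; exists k.
  have cs : adjacent (tag (conn s)) (tag s).
    by case: s {sc} => d k; apply/orP; right; apply/existsP; exists k.
  by rewrite !inE; apply/idP/idP => /connect_trans; apply; apply: connect1.
have clAC s : (tag (@conn _ _ D s) \in ~: A) = (tag s \in ~: A).
  by rewrite !in_setC clA.
have cardA : (0 < #|A|)%N by apply/card_gt0P; exists b; rewrite inE connect0.
have cardAC : (0 < #|~: A|)%N by apply/card_gt0P; exists c; rewrite !inE.
have cardD : (#|A| + #|~: A|)%N = nbox D by rewrite cardsC card_ord.
have [|s1 [s1c s1v]] := IHn (sub_diagram clA).
  by rewrite /= -ltnS; apply: leq_trans le_n; rewrite ltnS;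
     apply: leq_trans (eq_leq cardD); rewrite -addn1 leq_add2l.
have [|s2 [s2c s2v]] := IHn (sub_diagram clAC).
  by rewrite /= -ltnS; apply: leq_trans le_n; rewrite ltnS;
     apply: leq_trans (eq_leq cardD); rewrite -add1n leq_add2r.
exists (s1 ++ s2); split=> [p|S].
  by rewrite mem_cat => /orP[/s1c|/s2c].
by rewrite (value_sub_diagram S clA clAC) s1v s2v big_cat.
Qed.
End Decomposition.

(** * Linear independence of diagrams *)

Section LinearExtensions.
Variable K : closedFieldType.

Lemma lext_lext (M N : choiceType) (V : lmodType K) (h : M -> {malg K[N]})
    (h' : N -> V) f : lext h' (lext h f) = lext (fun m => lext h' (h m)) f.
Proof. exact: (linear_comb _ _ _ (lext_linear h')). Qed.

Lemma eq_lext (M : choiceType) (h h' : M -> K^o) f :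
  (forall m, h m = h' m :> K) -> lext h f = lext h' f :> K.
Proof. by move=> e; apply: eq_bigr => m _; rewrite e. Qed.

Lemma linear_ext (M : choiceType) (V : lmodType K) (F G : {malg K[M]} -> V) :
  linear F -> linear G -> (forall m, F << m >> = G << m >>) -> F =1 G.
Proof.
move=> linF linG e f; rewrite (sumsupp f) !linear_comb //.
by apply: eq_bigr => m _; rewrite e.
Qed.

Lemma lextZU (M : choiceType) (V : lmodType K) (h : M -> V) c m :
  lext h (c *: << m >>) = c *: h m.
Proof.
have h0 : lext h 0 = 0 by have := lext_linear h (-1) 0 0; rewrite !scaler0 addr0 scaleN1r addNr.
by have := lext_linear h c << m >> 0; rewrite h0 !addr0 lextU.
Qed.

Lemma malg_mulU (M : monomType) (m n : M) :
  << m >> * << n >> = << mmul m n >> :> {malg K[M]}.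
Proof. by rewrite malgM_def fgmulUU mulr1. Qed.

Lemma lext_monoid_morphism (M : conomType) (A : algType K) (h : M -> A) :
  h mone = 1 -> (forall m n, h (mmul m n) = h m * h n) ->
  GRing.monoid_morphism (lext h).
Proof.
move=> h1 hM; split=> [|f g]; first by rewrite [LHS](lextU h).
have linh := lext_linear h.
apply: (@linear_ext _ _ (fun f => lext h (f * g)) (fun f => lext h f * lext h g)).
- by move=> a u v; rewrite mulrDl -scalerAl linh.
- by move=> a u v; rewrite linh mulrDl -scalerAl.
move=> m; apply: (@linear_ext _ _ (fun g => lext h (_ * g)) (fun g => lext h _ * lext h g)).
- by move=> a u v; rewrite mulrDr -scalerAr linh.
- by move=> a u v; rewrite linh mulrDr -scalerAr.
by move=> n; rewrite malg_mulU !lextU.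
Qed.

Lemma tpureU (M N : choiceType) (m : M) (n : N) :
  << m >> \ot << n >> = << (m, n) >> :> {malg K[(M * N)%type]}.
Proof. by rewrite /tpure !lextU. Qed.

Lemma lext_tpure (M N : choiceType) (a : M -> K^o) (b : N -> K^o) f g :
  lext (fun x : (M * N)%type => a x.1 * b x.2 : K^o) (f \ot g) = lext a f * lext b g.
Proof.
rewrite /tpure lext_lext.
rewrite {1 3}/lext mulr_suml; apply: eq_bigr => m _.
rewrite lext_lext.
rewrite -scalerAl; congr (_ *: _); rewrite mulr_sumr; apply: eq_bigr => n _.
by rewrite lextU; apply: mulrCA.
Qed.
End LinearExtensions.

Section Characters.
Variable K : closedFieldType.

(* The points [x] form a semigroup up to the values of the characters [chi^~ m]. *)
Definition separating_characters (X : Type) (M : choiceType) (chi : X -> M -> K^o) :=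
  [/\ exists e, forall m, chi e m = 1,
      forall x y, exists z, forall m, chi z m = chi x m * chi y m &
      forall m n, (forall x, chi x m = chi x n) -> m = n].

(* Dedekind's lemma: comparing the relation at [x] and at the product of [x] and [y]
   eliminates [m]. *)
Lemma characters_independent (X : Type) (M : choiceType) (chi : X -> M -> K^o) :
  separating_characters chi -> forall (s : seq M) (c : M -> K), uniq s ->
  (forall x, \sum_(m <- s) c m * chi x m = 0) -> forall m, m \in s -> c m = 0.
Proof.
case=> [[e e1] chiM sep]; elim=> // m s IHs c /andP[ms us] c0.
have cs n : n \in s -> c n = 0.
  move=> ns; have : exists y, chi y n != chi y m.
    apply: contrapT => h; move: ms; rewrite -(sep n m) ?ns // => y.
    by apply/eqP/negP => /negP ne; apply: h; exists y.
  case=> y ne; have : c n * (chi y n - chi y m) = 0.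
    (* This relation is the one at the product [z] minus [chi y m] times the one at [x]; its term at
       [m] vanishes. *)
    apply: (IHs (fun k => c k * (chi y k - chi y m)) us _ n ns) => x.
    have [z zE] := chiM x y; have := c0 z; have := c0 x; rewrite !big_cons zE.
    move=> /eqP; rewrite addr_eq0 => /eqP cx.
    rewrite mulrA cx mulNr mulr_suml addrC -sumrB => cz; rewrite -[RHS]cz.
    by apply: eq_bigr => k _; rewrite zE mulrBr mulrBl mulrA; congr (_ - _); rewrite mulrAC.
  by move/eqP; rewrite mulf_eq0 subr_eq0 (negPf ne) orbF => /eqP.
move=> n; rewrite inE => /orP[/eqP->|/cs//].
have := c0 e; rewrite big_cons e1 mulr1 big_seq big1 ?addr0 // => k /cs->.
by rewrite mul0r.
Qed.

Lemma lext_inj (X : Type) (M : choiceType) (chi : X -> M -> K^o) :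
  separating_characters chi -> forall f g : {malg K[M]},
  (forall x, lext (chi x) f = lext (chi x) g) -> f = g.
Proof.
move=> sep f g e; apply/eqP; rewrite -subr_eq0; apply/eqP/malgP => m.
rewrite mcoeff0; have [/mcoeff_outdom//|] := boolP (m \notin msupp (f - g)).
rewrite negbK; apply: (characters_independent sep); first exact: fset_uniq.
move=> x; have := lext_linear (chi x) (-1) g f.
by rewrite e !scaleN1r addNr addrC.
Qed.

(** Putting a unit point in one coordinate isolates the other. This gives independence on K[X] (x)
    K[X] and, iterated, on the triple tensor power. *)
Lemma separating_characters_prod (X Y : Type) (M N : choiceType)
    (chi : X -> M -> K^o) (psi : Y -> N -> K^o) :
  separating_characters chi -> separating_characters psi ->
  separating_characters (fun (x : X * Y) (m : (M * N)%type) => chi x.1 m.1 * psi x.2 m.2 : K^o).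
Proof.
case=> [[e e1] chiM sep] [[e' e'1] psiM sep']; split.
- by exists (e, e') => m; rewrite e1 e'1 mulr1.
- move=> x y; have [z zE] := chiM x.1 y.1; have [z' z'E] := psiM x.2 y.2.
  by exists (z, z') => m; rewrite zE z'E /= mulrACA.
case=> m m' [n n'] h; congr pair.
  by apply: sep => x; have := h (x, e'); rewrite /= !e'1 !mulr1.
by apply: sep' => y; have := h (e, y); rewrite /= !e1 !mul1r.
Qed.
End Characters.

(** * Elements of K[X] and of its tensor powers as functions on structures *)

Section Evaluation.
Variables (K : closedFieldType) (r : nat) (t : 'I_r -> nat * nat).
Let M := dclass K t.

Lemma cval_mone S : cval S (mone : M) = 1 :> K.
Proof. exact (cval_one S). Qed.

Lemma cval_mmul S (m n : M) : cval S (mmul m n) = cval S m * cval S n :> K.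
Proof. exact (cval_mul S m n). Qed.

Lemma cval_separating : separating_characters (fun S (m : M) => cval S m : K^o).
Proof.
split.
- by exists (one_str K t) => m; rewrite /cval value_one_str.
- by move=> S1 S2; exists (tensprod S1 S2) => m; rewrite /cval value_tensprod.
- exact: dclassP.
Qed.

Lemma eval_inj (f g : {malg K[M]}) : (forall S, eval f S = eval g S) -> f = g.
Proof. exact: (lext_inj cval_separating). Qed.

Lemma eval2_inj (T U : {malg K[(M * M)%type]}) :
  (forall S1 S2, eval2 T S1 S2 = eval2 U S1 S2) -> T = U.
Proof.
move=> e; apply: (lext_inj (separating_characters_prod cval_separating cval_separating)).
by case=> S1 S2; apply: e.
Qed.

Lemma eval_diag S (D : diagram t) : eval (diag K D) S = value S D.
Proof. by rewrite /eval /diag lextU cvalE. Qed.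

Lemma eval_monoid_morphism S : GRing.monoid_morphism (fun f : {malg K[M]} => eval f S).
Proof.
apply: (@lext_monoid_morphism K M K^o (fun m => cval S m)); first exact: cval_mone.
exact: cval_mmul.
Qed.

Lemma eval2_monoid_morphism S1 S2 :
  GRing.monoid_morphism (fun T : {malg K[(M * M)%type]} => eval2 T S1 S2).
Proof.
apply: (@lext_monoid_morphism K (M * M)%type K^o (fun m => cval S1 m.1 * cval S2 m.2)).
  by rewrite /= !cval_mone mulr1.
by move=> m n; rewrite /= !cval_mmul mulrACA.
Qed.

Lemma induces_unique op (Delta Delta' : {malg K[M]} -> {malg K[(M * M)%type]}) :
  induces op Delta -> induces op Delta' -> Delta' =1 Delta.
Proof. by case=> _ H [_ H'] f; apply: eval2_inj => S1 S2; rewrite H H'. Qed.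

Lemma induces_lext op (h : M -> {malg K[(M * M)%type]}) :
  (forall m S1 S2, eval2 (h m) S1 S2 = cval (op S1 S2) m) -> induces op (lext h).
Proof.
move=> hE; split=> [|f S1 S2]; first exact: lext_linear.
by rewrite /eval2 /eval lext_lext; apply: eq_lext => m; apply: hE.
Qed.

(** Each axiom is tested on values: coassociativity becomes associativity of [op], the counit laws
    become neutrality of [e], and multiplicativity holds because evaluation at a structure is a ring
    morphism. *)
Lemma induced_bialgebra op e (Delta : {malg K[M]} -> {malg K[(M * M)%type]}) :
  induces op Delta ->
  (forall S1 S2 S3 m, cval (op (op S1 S2) S3) m = cval (op S1 (op S2 S3)) m :> K) ->
  (forall S (m : M), cval (op e S) m = cval S m) ->
  (forall S (m : M), cval (op S e) m = cval S m) ->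
  bialgebra Delta (fun f => eval f e).
Proof.
case=> linD DE opA op1S opS1.
have lineval S : scalar (fun f : {malg K[M]} => eval f S).
  exact: (lext_linear (fun m => cval S m : K^o)).
have evalU S (m : M) : eval << m >> S = cval S m by rewrite /eval lextU.
split=> //.
- move=> f; apply: (lext_inj (separating_characters_prod cval_separating
    (separating_characters_prod cval_separating cval_separating))).
  case=> S1 [S2 S3]; rewrite /= /tassoc lext_lext.
  (* Evaluating the inner [Delta] at [S1], [S2] amounts to evaluating its argument at [op S1 S2]. *)
  transitivity (eval2 (Delta f) (op S1 S2) S3).
    rewrite /tmap lext_lext.
    apply: eq_lext => m; rewrite -evalU -DE /= -(lextU (fun m => cval S3 m : K^o)).
    rewrite -lext_tpure; apply: eq_lext => x.
    by rewrite lextU /= mulrA.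
  rewrite DE /tmap lext_lext.
  transitivity (eval2 (Delta f) S1 (op S2 S3)).
    by rewrite !DE /eval; apply: eq_lext => m; apply: opA.
  apply: eq_lext => m; rewrite -evalU -[cval (op _ _) _]evalU -DE.
  exact/esym/(@lext_tpure _ _ _ (fun m => cval S1 m) (fun x => cval S2 x.1 * cval S3 x.2)).
- move=> f; apply: eval_inj => S; rewrite /eval lext_lext.
  transitivity (eval2 (Delta f) e S); last by rewrite DE /eval; apply: eq_lext => m; apply: op1S.
  by apply: eq_lext => m; rewrite lextZU lextU.
- move=> f; apply: eval_inj => S; rewrite /eval lext_lext.
  transitivity (eval2 (Delta f) S e); last by rewrite DE /eval; apply: eq_lext => m; apply: opS1.
  by apply: eq_lext => m; rewrite lextZU lextU; apply: mulrC.
- split=> [|f g]; apply: eval2_inj => S1 S2.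
    by rewrite DE (eval_monoid_morphism _).1 (eval2_monoid_morphism _ _).1.
  by rewrite (eval2_monoid_morphism _ _).2 !DE (eval_monoid_morphism _).2.
exact: eval_monoid_morphism.
Qed.
End Evaluation.

(** * The two coproducts *)

Section PrimitiveCoproduct.
Variables (K : closedFieldType) (r : nat) (t : 'I_r -> nat * nat).
Let M := dclass K t.

(* The components of a chosen representative; their number is additive in [m] by
   [cval_dsum_one]. *)
Definition components (m : M) : seq (diagram t) :=
  projT1 (cid (connected_decomposition K (repr m))).

Lemma components_connected m p : p \in components m -> connected p.
Proof. exact: (projT2 (cid (connected_decomposition K (repr m)))).1. Qed.

Lemma cval_components S (m : M) : cval S m = \prod_(p <- components m) value S p.
Proof. exact: (projT2 (cid (connected_decomposition K (repr m)))).2. Qed.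

Lemma cval_dsum S1 S2 (m : M) :
  cval (dsum S1 S2) m = \prod_(p <- components m) (value S1 p + value S2 p).
Proof.
rewrite cval_components big_seq [RHS]big_seq; apply: eq_bigr => p pm.
by rewrite value_dsum_connected //; apply: components_connected pm.
Qed.

Lemma cval_zero_str (m : M) :
  cval (zero_str K t) m = \prod_(p <- components m) (0 : K).
Proof.
rewrite cval_components big_seq [RHS]big_seq; apply: eq_bigr => p /components_connected[p0 _].
exact: value_zero_str.
Qed.

Definition comult_dsum (m : M) : {malg K[(M * M)%type]} :=
  \prod_(p <- components m) (diag K p \ot 1 + 1 \ot diag K p).

(** The target [A] is general because the formula serves twice: with A = K it computes values, and
    with A = K[X] the convolution of the antipode and the identity. *)
Lemma lext_comult_dsum (A : comAlgType K) (a b : M -> A) (m : M) :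
  a mone = 1 -> (forall m n, a (mmul m n) = a m * a n) ->
  b mone = 1 -> (forall m n, b (mmul m n) = b m * b n) ->
  lext (fun x : (M * M)%type => a x.1 * b x.2) (comult_dsum m) =
  \prod_(p <- components m) (a (cls K p) + b (cls K p)).
Proof.
move=> a1 aM b1 bM; pose h (x : (M * M)%type) : A := a x.1 * b x.2.
have [h1 hM] : GRing.monoid_morphism (lext h).
  apply: lext_monoid_morphism; rewrite /h /=; first by rewrite a1 b1 mulr1.
  by move=> x y /=; rewrite aM bM mulrACA.
rewrite -/h (big_morph _ hM h1); apply: eq_bigr => p _.
have hD f g : lext h (f + g) = lext h f + lext h g.
  by have := lext_linear h 1 f g; rewrite !scale1r.
by rewrite hD /diag !tpureU !lextU /h /= a1 b1 mulr1 mul1r.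
Qed.

Lemma comult_dsum_induces : induces (@dsum K r t) (lext comult_dsum).
Proof.
apply: induces_lext => m S1 S2; rewrite cval_dsum.
have := @lext_comult_dsum K^o (fun m => cval S1 m) (fun m => cval S2 m) m
  (cval_mone S1) (cval_mmul S1) (cval_mone S2) (cval_mmul S2).
by rewrite /eval2 => ->; apply: eq_bigr => p _; rewrite !cvalE.
Qed.

Lemma dsum_bialgebra : bialgebra (lext comult_dsum) (@counit_dsum K r t).
Proof.
have dsumA S1 S2 S3 (m : M) :
    cval (dsum (dsum S1 S2) S3) m = cval (dsum S1 (dsum S2 S3)) m.
  rewrite !cval_dsum big_seq [RHS]big_seq; apply: eq_bigr => p /components_connected pc.
  by rewrite !value_dsum_connected // addrA.
have value0 p m : p \in components m -> value (zero_str K t) p = 0.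
  by case/components_connected => p0 _; apply: value_zero_str.
have dsum0l S (m : M) : cval (dsum (zero_str K t) S) m = cval S m.
  rewrite cval_dsum cval_components big_seq [RHS]big_seq.
  by apply: eq_bigr => p pm; rewrite (value0 _ _ pm) add0r.
have dsum0r S (m : M) : cval (dsum S (zero_str K t)) m = cval S m.
  rewrite cval_dsum cval_components big_seq [RHS]big_seq.
  by apply: eq_bigr => p pm; rewrite (value0 _ _ pm) addr0.
exact: induced_bialgebra comult_dsum_induces dsumA dsum0l dsum0r.
Qed.

(** The chosen list [components (cls K p)] need not be the one-element list of [p], so the identity
    is checked on values. *)
Lemma comult_dsum_connected (p : diagram t) : connected p ->
  lext comult_dsum (diag K p) = diag K p \ot 1 + 1 \ot diag K p.
Proof.
move=> pc; apply: eval2_inj => S1 S2; rewrite (comult_dsum_induces.2) eval_diag.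
rewrite value_dsum_connected // /eval2.
pose h (x : (M * M)%type) : K^o := cval S1 x.1 * cval S2 x.2.
have hD f g : lext h (f + g) = lext h f + lext h g.
  by have := lext_linear h 1 f g; rewrite !scale1r.
rewrite hD /diag !tpureU !lextU /h /= !cval_mone !cvalE.
by rewrite mulr1 mul1r.
Qed.

Lemma counit_dsum_connected (p : diagram t) : connected p -> counit_dsum (diag K p) = 0.
Proof. by case=> p0 _; rewrite /counit_dsum eval_diag value_zero_str. Qed.

Lemma cval_dsum_one (m : M) :
  cval (dsum (one_str K t) (one_str K t)) m = 2 ^+ size (components m) :> K.
Proof.
rewrite cval_dsum (eq_bigr (fun=> 2)) => [|p _]; last by rewrite value_one_str.
by rewrite big_const_seq count_predT iter_mulr_1.
Qed.

Hypothesis charK : [pchar K] =i pred0.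

(** Characteristic zero enters here: it lets the number of components be read off from a value in
    K. *)
Lemma pow2_inj n1 n2 : 2 ^+ n1 = 2 ^+ n2 :> K -> n1 = n2.
Proof.
wlog le12 : n1 n2 / (n1 <= n2)%N.
  by move=> H e; case/orP: (leq_total n1 n2) => /H; [apply | move/(_ (esym e))].
rewrite -!natrX => /eqP; rewrite eq_sym -subr_eq0 -natrB ?leq_pexp2l //.
rewrite ((pcharf0P K).1 charK) subn_eq0 leq_exp2l // => le21.
by apply/eqP; rewrite eqn_leq le12.
Qed.

Definition component_sign (m : M) : K := (-1) ^+ size (components m).

Lemma component_sign_mone : component_sign mone = 1.
Proof.
rewrite /component_sign (@pow2_inj (size (components mone)) 0) ?expr0 //.
by rewrite -cval_dsum_one cval_mone.
Qed.

Lemma component_sign_mmul m n :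
  component_sign (mmul m n) = component_sign m * component_sign n.
Proof.
rewrite /component_sign -exprD; congr (_ ^+ _); apply: pow2_inj.
by rewrite exprD -!cval_dsum_one cval_mmul.
Qed.

Lemma component_sign_connected (p : diagram t) :
  connected p -> component_sign (cls K p) = -1.
Proof.
move=> pc; rewrite /component_sign (@pow2_inj (size (components (cls K p))) 1) ?expr1 //.
by rewrite -cval_dsum_one cvalE value_dsum_connected // value_one_str.
Qed.

Lemma dsum_hopf_algebra : hopf_algebra (lext comult_dsum) (@counit_dsum K r t).
Proof.
split; first exact: dsum_bialgebra.
pose a (m : M) : {malg K[M]} := component_sign m *: << m >>.
pose b (m : M) : {malg K[M]} := << m >>.
have a1 : a mone = 1 by rewrite /a component_sign_mone scale1r.
have aM m n : a (mmul m n) = a m * a n.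
  by rewrite /a component_sign_mmul -malg_mulU -scalerAl -scalerAr scalerA.
have b1 : b mone = 1 by [].
have bM m n : b (mmul m n) = b m * b n by rewrite /b malg_mulU.
(* Here [a] is the antipode on the basis and [b] the identity; on a connected diagram they
   cancel. *)
have ab p m : p \in components m -> a (cls K p) + b (cls K p) = 0.
  by move=> /components_connected pc; rewrite /a component_sign_connected // scaleN1r addNr.
(* The empty product is 1 and every other product of zeros is 0, which is exactly the counit. *)
have prod0 (m : M) : counit_dsum << m >> *: 1 = \prod_(p <- components m) (0 : {malg K[M]}).
  rewrite /counit_dsum /eval lextU cval_zero_str.
  by case: (components m) => [|p s]; rewrite ?big_nil ?scale1r // !big_cons !mul0r scale0r.
have convE (h : (M * M)%type -> {malg K[M]}) f :
    (forall m, lext h (comult_dsum m) = \prod_(p <- components m) (0 : {malg K[M]})) ->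
    lext h (lext comult_dsum f) = counit_dsum f *: 1.
  move=> hE; rewrite lext_lext; move: f.
  apply: (@linear_ext _ _ _ _ (fun f => counit_dsum f *: 1)).
  - exact: lext_linear.
  - move=> c u v; rewrite scalerA -scalerDl; congr (_ *: _).
    exact: (lext_linear (fun m => cval (zero_str K t) m : K^o) c u v).
  by move=> m; rewrite lextU hE prod0.
exists (lext a); split=> [|f|f]; first exact: lext_linear.
- rewrite -(convE (fun x => a x.1 * b x.2)) => [|m]; last first.
    rewrite lext_comult_dsum // big_seq [RHS]big_seq.
    by apply: eq_bigr => p pm; rewrite (ab p m pm).
  rewrite /tmul /tmap lext_lext; move: (lext comult_dsum f).
  apply: linear_ext => [||x]; try exact: lext_linear.
  by rewrite !lextU /tpure lextZU lextU lextZU scalerAl.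
rewrite -(convE (fun x => b x.1 * a x.2)) => [|m]; last first.
  rewrite lext_comult_dsum // big_seq [RHS]big_seq.
  by apply: eq_bigr => p pm; rewrite addrC (ab p m pm).
rewrite /tmul /tmap lext_lext; move: (lext comult_dsum f).
apply: linear_ext => [||x]; try exact: lext_linear.
by rewrite !lextU /tpure lextU lextZU lextZU scalerAr.
Qed.
End PrimitiveCoproduct.

Section GroupLikeCoproduct.
Variables (K : closedFieldType) (r : nat) (t : 'I_r -> nat * nat).
Let M := dclass K t.

Definition comult_tensprod (m : M) : {malg K[(M * M)%type]} := << (m, m) >>.

Lemma cval_tensprod S1 S2 (m : M) : cval (tensprod S1 S2) m = cval S1 m * cval S2 m.
Proof. exact: value_tensprod. Qed.

Lemma comult_tensprod_induces : induces (@tensprod K r t) (lext comult_tensprod).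
Proof.
by apply: induces_lext => m S1 S2; rewrite cval_tensprod /eval2 /comult_tensprod lextU.
Qed.

Lemma tensprod_bialgebra : bialgebra (lext comult_tensprod) (@counit_tensprod K r t).
Proof.
have cval1 (m : M) : cval (one_str K t) m = 1 by exact: value_one_str.
apply: (induced_bialgebra comult_tensprod_induces) => [S1 S2 S3 m|S m|S m].
- by rewrite !cval_tensprod mulrA.
- by rewrite cval_tensprod cval1 mul1r.
- by rewrite cval_tensprod cval1 mulr1.
Qed.
End GroupLikeCoproduct.

Theorem theorem1p5 (K : closedFieldType) (charK : [pchar K] =i pred0)
    (r : nat) (t : 'I_r -> nat * nat) :
  (exists Delta : {malg K[dclass K t]} -> {malg K[(dclass K t * dclass K t)%type]},
    [/\ induces (@dsum K r t) Delta,
        forall Delta', induces (@dsum K r t) Delta' -> Delta' =1 Delta,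
        hopf_algebra Delta (@counit_dsum K r t) &
        forall p : diagram t, connected p ->
          Delta (diag K p) = diag K p \ot 1 + 1 \ot diag K p /\
          counit_dsum (diag K p) = 0]) /\
  (exists Deltat : {malg K[dclass K t]} -> {malg K[(dclass K t * dclass K t)%type]},
    [/\ induces (@tensprod K r t) Deltat,
        forall Delta', induces (@tensprod K r t) Delta' -> Delta' =1 Deltat,
        bialgebra Deltat (@counit_tensprod K r t) &
        forall p : diagram t,
          Deltat (diag K p) = diag K p \ot diag K p /\
          counit_tensprod (diag K p) = 1]).
Proof.
split.
  exists (lext (@comult_dsum K r t)); split.
  - exact: comult_dsum_induces.
  - by move=> Delta'; apply: (induces_unique (@comult_dsum_induces K r t)).
  - exact: dsum_hopf_algebra.
  - by move=> p pc; split; [apply: comult_dsum_connected | apply: counit_dsum_connected].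
exists (lext (@comult_tensprod K r t)); split.
- exact: comult_tensprod_induces.
- by move=> Delta'; apply: (induces_unique (@comult_tensprod_induces K r t)).
- exact: tensprod_bialgebra.
move=> p; split; first by rewrite /diag lextU tpureU.
by rewrite /counit_tensprod eval_diag value_one_str.
Qed.
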